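(* Let $v$ be a weight on $\mathbb{R}^{n}$ and let $\vec{w}=(w_{1},w_{2})$ be a pair of weights on $\mathbb{R}^{n}$. Assume that $$0\leq\alpha<n,\quad 0<q\leq p<\infty,\quad 0<t\leq s<r\leq\infty,\quad \vec q=(q_1,q_2),\quad 0<r_{i}\leq q_{i}<\infty\ (i=1,2),$$ where $1/q=1/q_{1}+1/q_{2}$, and put $\vec R=(r_1,r_2)$. Suppose that $$\frac{\alpha}{n}\geq\frac{1}{r},\quad\frac{1}{s}=\frac{1}{p}+\frac{1}{r}-\frac{\alpha}{n},\quad\frac{1}{t}=\frac{1}{q}+\frac{1}{r}-\frac{\alpha}{n}.$$ Let $$[v,\vec{w}]_{t,\vec{q}}^{r,s}=\sup_{\substack{Q,Q'\in\mathcal{D}(\mathbb{R}^{n})\\ Q\subseteq Q'}}\left(\frac{|Q|}{|Q'|}\right)^{\frac{1}{s}}|Q'|^{\frac{1}{r}}\left(\frac1{|Q|}\int_{Q}v^{t}\right)^{\frac{1}{t}}\prod_{i=1}^{2}\left(\frac1{|Q'|}\int_{Q'}w_{i}^{-r_{i}(q_{i}/r_{i})'}\right)^{\frac{1}{r_{i}(q_{i}/r_{i})'}},$$ where the $i$-th factor of the product means $\|w_{i}^{-1}\|_{L^{\infty}(Q')}$ when $q_i=r_i$. Then the weighted weak type inequality $$\sup_{\lambda>0}|Q_{0}|^{\frac{1}{s}-\frac{1}{t}}\lambda \left(v^{t}(\{x\in Q_{0}: M_{\alpha,\vec{R}}(f,g)(x)>\lambda\})\right)^{\frac{1}{t}}\leq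 K \sup_{\substack{Q\in\mathcal{D}(\mathbb{R}^{n})\\ Q\supseteq Q_{0}}}|Q|^{1/p}\left(\frac1{|Q|}\int_{Q}(|f|w_{1})^{q_{1}}\right)^{1/q_{1}}\left(\frac1{|Q|}\int_{Q}(|g|w_{2})^{q_{2}}\right)^{1/q_{2}}$$ holds, with some finite constant $K$, for every $Q_{0}\in\mathcal{D}(\mathbb{R}^{n})$ and all $f,g$, if and only if $[v,\vec{w}]_{t,\vec{q}}^{r,s}<\infty$; and in that case it holds with $K=C[v,\vec{w}]_{t,\vec{q}}^{r,s}$.
   Context: $C$ denotes a constant independent of the essential variables (in particular of $f$, $g$ and $Q_0$); $f,g$ are measurable functions on $\mathbb{R}^n$. For $1<u<\infty$, $u'=u/(u-1)$. ''Weight'' has its usual meaning (a nonnegative locally integrable function). For a measurable set $E$, $v^t(E)=\int_E v(x)^t\,dx$. $\mathcal{D}(\mathbb{R}^{n})=\{2^{-k}([0,1)^{n}+m):k\in\mathbb{Z},\,m\in\mathbb{Z}^{n}\}$ is the set of dyadic cubes. For $\vec R=(r_1,r_2)$, $$M_{\alpha,\vec{R}}(f,g)(x)=\sup_{\mathcal{D}(\mathbb{R}^{n})\ni Q\ni x}|Q|^{\frac{\alpha}{n}}\left(\frac1{|Q|}\int_{Q}|f|^{r_{1}}\right)^{\frac{1}{r_{1}}}\left(\frac1{|Q|}\int_{Q}|g|^{r_{2}}\right)^{\frac{1}{r_{2}}}.$$ *)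

(* Defs.v *)
From HB Require Import structures.
From mathcomp Require Import all_boot all_order all_algebra.
From mathcomp Require Import all_classical all_reals all_analysis.

Set Implicit Arguments.
Unset Strict Implicit.
Unset Printing Implicit Defensive.

Import Order.TTheory GRing.Theory Num.Theory.
Import numFieldNormedType.Exports.

Local Open Scope classical_set_scope.
Local Open Scope ring_scope.
Local Open Scope ereal_scope.

Section cons_measure.
Context {R : realType} {n : nat}.
Local Notation RT := (measurableTypeR R).
Variable m : {sigma_finite_measure set (n.-tuple RT) -> \bar R}.

Definition cons_pair (z : RT * n.-tuple RT) : n.+1.-tuple RT :=
  [tuple of z.1 :: z.2].

Lemma measurable_cons_pair : measurable_fun [set: _] cons_pair.
Proof. exact: measurable_cons. Qed.

Definition cons_measure : set (n.+1.-tuple RT) -> \bar R :=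
  pushforward (lebesgue_measure \x m) cons_pair.

Let cons_measure0 : cons_measure set0 = 0.
Proof. by rewrite /cons_measure /pushforward preimage_set0 measure0. Qed.

Let cons_measure_ge0 A : 0 <= cons_measure A.
Proof. by rewrite /cons_measure /pushforward; exact: measure_ge0. Qed.

Let cons_measure_sigma_additive : semi_sigma_additive cons_measure.
Proof.
move=> F mF tF mUF; rewrite /cons_measure /pushforward preimage_bigcup.
apply: measure_semi_sigma_additive.
- by move=> k; rewrite -[X in measurable X]setTI; exact: measurable_cons_pair.
- apply/trivIsetP => /= i j _ _ ij; rewrite -preimage_setI.
  by move/trivIsetP : tF => /(_ _ _ _ _ ij) ->//; rewrite preimage_set0.
- rewrite -preimage_bigcup -[X in measurable X]setTI.
  exact: measurable_cons_pair.
Qed.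

HB.instance Definition _ := isMeasure.Build _ _ _ cons_measure
  cons_measure0 cons_measure_ge0 cons_measure_sigma_additive.

Let cons_measure_sigma_finite : sigma_finite setT cons_measure.
Proof.
have /sigma_finiteP[F [TF ndF Foo]] := sigma_finiteT (@lebesgue_measure R).
have /sigma_finiteP[G [TG ndG Goo]] := sigma_finiteT m.
pose h (x : n.+1.-tuple RT) : (RT * n.-tuple RT)%type :=
  (thead x, [tuple of behead x]).
have hK : cancel cons_pair h.
  by move=> [a b]; rewrite /h /cons_pair /= theadE; congr pair; exact: val_inj.
have mh : measurable_fun setT h.
  apply/measurable_fun_pairP; split => /=; first exact: measurable_tnth.
  exact: measurable_behead.
exists (fun k => h @^-1` (F k `*` G k)).
  apply/esym; rewrite -subTset => x _.
  have [i _ Fi] : (\bigcup_i F i) (thead x) by rewrite -TF.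
  have [j _ Gj] : (\bigcup_i G i) [tuple of behead x] by rewrite -TG.
  exists (maxn i j) => //; split => /=.
    by move: Fi; exact/subsetPset/ndF/leq_maxl.
  by move: Gj; exact/subsetPset/ndG/leq_maxr.
move=> k; have [mF Fkoo] := Foo k; have [mG Gkoo] := Goo k; split.
  by rewrite -[X in measurable X]setTI; apply: mh => //; exact: measurableX.
rewrite /cons_measure /pushforward -comp_preimage.
rewrite (_ : h \o cons_pair = id); last by apply/funext => z; exact: hK.
by rewrite /= product_measure1E// lte_mul_pinfty// ge0_fin_numE.
Qed.

HB.instance Definition _ := Measure_isSigmaFinite.Build _ _ _ cons_measure
  cons_measure_sigma_finite.

End cons_measure.

(* Lebesgue measure on the Borel sets of R^n *)
Fixpoint borel_lebesgue (R : realType) (n : nat) :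
    {sigma_finite_measure set (n.-tuple (measurableTypeR R)) -> \bar R} :=
  match n with
  | 0 => dirac ([tuple] : 0.-tuple (measurableTypeR R))
  | k.+1 => cons_measure (borel_lebesgue R k)
  end.

(* Since the measure is obtained by Caratheodory extension, the measurable sets
   of [Rn R n] are the Lebesgue measurable ones. *)
Definition lebesgue_outer (R : realType) (n : nat) :
    {outer_measure set (n.-tuple (measurableTypeR R)) -> \bar R} :=
  mu_ext (borel_lebesgue R n).

Definition Rn (R : realType) (n : nat) := caratheodory_type (lebesgue_outer R n).

Definition lebn (R : realType) (n : nat) : {measure set (Rn R n) -> \bar R} :=
  lebesgue_outer R n.

Section dyadic.
Context {R : realType} {n : nat}.
Local Notation mu := (lebn R n).
Implicit Types (Q E : set (Rn R n)) (v w f g : Rn R n -> R).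

(* the cubes 2^-k ([0, 1[^n + m) *)
Definition dyadic : set (set (Rn R n)) :=
  [set Q | exists (k : int) (m : 'I_n -> int), Q = [set x | forall i,
    ((2 : R) ^ (- k) * (m i)%:~R <= tnth x i < 2 ^ (- k) * ((m i)%:~R + 1))%R]].

(* The library's topology on R^n lives on row vectors. *)
Definition weight w := [/\ measurable_fun [set: Rn R n] w,
  forall x, (0 <= w x)%R &
  forall K : set (Rn R n), compact [set (\row_i (tnth x i : R))%R | x in K] ->
    \int[mu]_(x in K) (w x)%:E < +oo].

Definition mean Q (h : Rn R n -> \bar R) : \bar R :=
  (\int[mu]_(x in Q) h x) / mu Q.

Definition pmass (t : R) v E : \bar R := \int[mu]_(x in E) (v x `^ t)%:E.

Definition maximal (alpha r1 r2 : R) f g (x : Rn R n) : \bar R :=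
  ereal_sup [set mu Q `^ (alpha / n%:R)
      * mean Q (fun y => (`|f y| `^ r1)%:E) `^ r1^-1
      * mean Q (fun y => (`|g y| `^ r2)%:E) `^ r2^-1
    | Q in [set Q | dyadic Q /\ Q x]].

Definition conjugate (u : R) : R := (u / (u - 1))%R.

(* The inverse of [w] is taken in the extended reals, where 0^-1 = +oo, whereas
   a negative real power of 0 would be 0 in the library. *)
Definition dual_factor (w : Rn R n -> R) (qi ri : R) Q : \bar R :=
  let winv x := ((w x)%:E^-1)%E in
  if qi == ri then 'N[mu]_(+oo)[winv \_ Q]
  else let e := (ri * conjugate (qi / ri))%R in
       mean Q (fun x => winv x `^ e) `^ e^-1.

(* 1 / r for 0 < r <= +oo, so that 1 / +oo = 0 *)
Definition rinv (r : \bar R) : R := fine (r^-1)%E.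

Definition weight_const (t q1 q2 : R) (r : \bar R) (s r1 r2 : R) v w1 w2 :
    \bar R :=
  ereal_sup [set y | exists Q Q', [/\ dyadic Q, dyadic Q', Q `<=` Q' &
    y = (mu Q / mu Q') `^ s^-1 * mu Q' `^ (rinv r)
        * mean Q (fun x => (v x `^ t)%:E) `^ t^-1
        * (dual_factor w1 q1 r1 Q' * dual_factor w2 q2 r2 Q')]].

Definition weak_type_bound (alpha p t s q1 q2 r1 r2 : R) v w1 w2 (K : \bar R) :=
  forall (Q0 : set (Rn R n)) (f g : Rn R n -> R), dyadic Q0 ->
    measurable_fun [set: Rn R n] f -> measurable_fun [set: Rn R n] g ->
  ereal_sup [set mu Q0 `^ (s^-1 - t^-1) * lambda%:E
      * pmass t v [set x | Q0 x /\ lambda%:E < maximal alpha r1 r2 f g x]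
        `^ t^-1 | lambda in [set l : R | (0 < l)%R]]
  <= K * ereal_sup [set mu Q `^ p^-1
      * mean Q (fun x => ((`|f x| * w1 x) `^ q1)%:E) `^ q1^-1
      * mean Q (fun x => ((`|g x| * w2 x) `^ q2)%:E) `^ q2^-1
    | Q in [set Q | dyadic Q /\ Q0 `<=` Q]].

End dyadic.

(* Main.v *)
Require Import Defs.
From mathcomp Require Import all_boot all_order all_algebra.
From mathcomp Require Import all_classical all_reals all_analysis.
From mathcomp Require Import ess_sup_inf measurable_realfun.
From mathcomp Require Import ring lra zify.

(** Let [|Q|] be the volume of a cube, [D_i(E)] the norm of [w_i^-1] on [E] in the
    Lebesgue space whose exponent [e_i] satisfies [1/e_i = 1/r_i - 1/q_i], and
    [V(Q) = |Q|^(1/s - 1/t) v^t(Q)^(1/t)].  Once the averages are undone, the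
    weight condition says that [V(Q) D_1(Q') D_2(Q') <= W |Q'|^theta] whenever
    [Q] is contained in [Q'], where [W] is the supremum of the statement and
    [theta = 1/s - 1/r + 1/e_1 + 1/e_2 > 0] ([const_termE]).

    Sufficiency, with constant [C = 1].  If the bilinear average of [(f, g)] on
    [Q'] exceeds [lambda], Hoelder's inequality against the weights
    ([weighted_hoelder]) and the weight condition bound [lambda V(Q)] by [W] times
    the average of [(f w_1, g w_2)] on [Q'], for all [Q] inside [Q']
    ([vmass_le]).  If one such [Q'] contains [Q_0], this with [Q = Q_0] is the
    claim.  Otherwise the set where the maximal function exceeds [lambda] is a
    union of dyadic subcubes of [Q_0]; the case [Q = Q'] bounds the [v^t]-mass of
    each of them, and the masses are added over the disjoint maximal cubes.  The
    sum is controlled since [t >= q = 1/(1/q_1 + 1/q_2)]: by the weighted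
    arithmetic-geometric inequality ([young_powR]) the bound on each cube is the
    integral over it of one fixed function, so [dyadic_covering] concludes.

    Necessity.  [weighted_hoelder_sharp] provides near-extremizers of Hoelder's
    inequality supported in a given set.  Testing on extremizers supported in the
    whole of [Q'] is not enough, because the supremum on the right-hand side also
    runs over the cubes between [Q] and [Q'].  If one of the two functions lives
    on [Q'] minus its dyadic child around [Q], those cubes contribute nothing and
    the desired bound holds with that difference in place of [Q'] in one factor
    ([testing]).  The full bound follows by induction along the ancestors of [Q]
    ([ancestors_le]).  In passing from a cube [P] to its parent [Q'], either some
    [D_i(Q')] is comparable with [D_i] of [Q'] minus [P]
    ([dual_norm_dichotomy]), and testing applies, or
    [D_1(Q') D_2(Q') <= 2^(n theta) D_1(P) D_2(P)], a growth compensated by the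
    factor [|Q'|^theta = 2^(n theta) |P|^theta].  This is where [s < r], that is
    [theta > 0], is used. *)

Set Implicit Arguments.
Unset Strict Implicit.
Unset Printing Implicit Defensive.

Import Order.TTheory GRing.Theory Num.Theory.
Import numFieldNormedType.Exports.

Local Open Scope classical_set_scope.
Local Open Scope ring_scope.

(** * Real and extended real powers *)

Section powers.
Context {R : realType}.

(** Weighted arithmetic-geometric inequality, raised to a power [t / q >= 1]. *)
Lemma young_powR (q t q1 q2 a b A B : R) :
  0 < q1 -> 0 < q2 -> q^-1 = q1^-1 + q2^-1 -> 0 < q -> q <= t ->
  0 <= a <= A -> 0 <= b <= B -> 0 < A -> 0 < B ->
  (a `^ q1^-1 * b `^ q2^-1) `^ t <=
  (A `^ q1^-1 * B `^ q2^-1) `^ t * (q / q1 * (a / A) + q / q2 * (b / B)).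
Proof.
move=> q10 q20 q_eq q0 qt /andP[a0 aA] /andP[b0 bB] A0 B0.
pose u := (a / A) `^ (q / q1); pose v := (b / B) `^ (q / q2).
have aA0 : 0 <= a / A by rewrite divr_ge0 ?(ltW A0).
have bB0 : 0 <= b / B by rewrite divr_ge0 ?(ltW B0).
have aA1 : a / A <= 1 by rewrite ler_pdivrMr// mul1r.
have bB1 : b / B <= 1 by rewrite ler_pdivrMr// mul1r.
have u0 : 0 <= u by exact: powR_ge0.
have v0 : 0 <= v by exact: powR_ge0.
have u1 : u <= 1.
  have -> : 1 = 1 `^ (q / q1) :> R by rewrite powR1.
  by rewrite ge0_ler_powR ?nnegrE// divr_ge0 ?(ltW q0) ?(ltW q10).
have v1 : v <= 1.
  have -> : 1 = 1 `^ (q / q2) :> R by rewrite powR1.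
  by rewrite ge0_ler_powR ?nnegrE// divr_ge0 ?(ltW q0) ?(ltW q20).
have uv : u * v <= q / q1 * (a / A) + q / q2 * (b / B).
  have := @conjugate_powR _ u v (q1 / q) (q2 / q) u0 v0.
  rewrite !divr_gt0// => /(_ isT isT).
  rewrite !invfM !invrK ![_^-1 * q]mulrC -mulrDr -q_eq mulfV ?gt_eqF// => /(_ erefl).
  rewrite /u /v -!powRrM.
  have -> : q / q1 * (q1 / q) = 1 by field; rewrite !gt_eqF.
  have -> : q / q2 * (q2 / q) = 1 by field; rewrite !gt_eqF.
  by rewrite !powRr1// ![_ / _ * (q / _)]mulrC.
have t0 : 0 < t by rewrite (lt_le_trans q0).
have -> : (a `^ q1^-1 * b `^ q2^-1) `^ t =
    (A `^ q1^-1 * B `^ q2^-1) `^ t * (u * v) `^ (t / q).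
  have aE : a = A * (a / A) by rewrite mulrC divfK ?gt_eqF.
  have bE : b = B * (b / B) by rewrite mulrC divfK ?gt_eqF.
  rewrite /u /v [in LHS]aE [in LHS]bE; move: (a / A) (b / B) aA0 bB0 => x y x0 y0.
  rewrite (powRM _ (ltW A0) x0) (powRM _ (ltW B0) y0) mulrACA.
  have -> : (x `^ (q / q1) * y `^ (q / q2)) `^ (t / q) =
      (x `^ q1^-1 * y `^ q2^-1) `^ t.
    rewrite !(powRM _ (powR_ge0 _ _) (powR_ge0 _ _)) -!powRrM.
    have -> : q / q1 * (t / q) = q1^-1 * t by field; rewrite !gt_eqF.
    by have -> : q / q2 * (t / q) = q2^-1 * t by field; rewrite !gt_eqF.
  by rewrite -[RHS]powRM ?mulr_ge0 ?powR_ge0.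
rewrite ler_wpM2l ?powR_ge0//; apply: le_trans uv.
have [->|uv0] := eqVneq (u * v) 0.
  by rewrite powR0// mulf_neq0 ?invr_eq0 ?gt_eqF.
apply: ge1r_powR; last by rewrite ler_pdivlMr// mul1r.
by rewrite lt_def uv0 mulr_ge0//= mulr_ile1.
Qed.

Local Open Scope ereal_scope.

Lemma le_poweR (r : R) (x y : \bar R) : (0 <= r)%R -> 0 <= x -> x <= y ->
  x `^ r <= y `^ r.
Proof.
move=> r0 x0 xy; apply: gt0_ler_poweR => //; rewrite in_itv/= leey andbT//.
exact: le_trans xy.
Qed.

Lemma poweRK (r : R) (x : \bar R) : r != 0%R -> 0 <= x -> (x `^ r) `^ r^-1 = x.
Proof. by move=> r0 x0; rewrite -poweRrM mulfV// poweRe1. Qed.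

Lemma poweRVK (r : R) (x : \bar R) : r != 0%R -> 0 <= x -> (x `^ r^-1) `^ r = x.
Proof. by move=> r0 x0; rewrite -poweRrM mulVf// poweRe1. Qed.

Lemma le_poweR_inj (r : R) (x y : \bar R) : (0 < r)%R -> 0 <= x -> 0 <= y ->
  x `^ r <= y `^ r -> x <= y.
Proof.
move=> r0 x0 y0 xy; rewrite -(@poweRK r x) ?gt_eqF// -(@poweRK r y) ?gt_eqF//.
by apply: le_poweR; rewrite ?invr_ge0 ?(ltW r0)// poweR_ge0.
Qed.

Lemma lte_real_between (x : R) (y : \bar R) : x%:E < y ->
  exists2 z : R, (x < z)%R & z%:E < y.
Proof.
case: y => [y| |//]; rewrite ?lte_fin => xy.
  by exists ((x + y) / 2)%R; rewrite ?lte_fin; lra.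
by exists (x + 1)%R; rewrite ?ltry//; lra.
Qed.

Local Close Scope ereal_scope.

(** To bound [a * D] it is enough to bound [a * N] for the reals [0 < N < D]. *)
Lemma mule_le_approx (a b D : \bar R) : (0 <= a)%E -> (0 <= b)%E ->
  (0 <= D)%E -> (forall N : R, 0 < N -> (N%:E < D)%E -> (a * N%:E <= b)%E) ->
  (a * D <= b)%E.
Proof.
move=> a0 b0 D0 H; have [->|D_neq0] := eqVneq D 0%E; first by rewrite mule0.
have D_gt0 : (0 < D)%E by rewrite lt0e D_neq0.
have [a_eq0|a_neq0] := eqVneq a 0%E; first by rewrite a_eq0 mul0e.
have a_gt0 : (0 < a)%E by rewrite lt0e a_neq0.
move: b b0 H => [b b0 H| |//]; last by move=> *; rewrite leey.
have [N0 N00 N0D] := lte_real_between D_gt0.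
move: a a0 a_neq0 a_gt0 H => [a a0 _ a_gt0 H|_ _ _ H|//]; last first.
  by have := H _ N00 N0D; rewrite gt0_mulye ?lte_fin// leye_eq.
rewrite lte_fin in a_gt0; rewrite leNgt; apply/negP => bD.
have /lte_real_between[N bN ND] : ((b / a)%:E < D)%E.
  by rewrite mulrC EFinM lte_pdivrMl.
have N_gt0 : 0 < N by rewrite (le_lt_trans _ bN)// divr_ge0// ltW.
by have := H _ N_gt0 ND; rewrite -EFinM lee_fin leNgt -ltr_pdivrMl// mulrC bN.
Qed.

End powers.

(** * Norms dual to a weight *)

Section weighted_norms.
Local Open Scope ereal_scope.
Context d {T : measurableType d} {R : realType}.
Variable mu : {measure set T -> \bar R}.
Implicit Types (E F : set T) (f g w : T -> R) (q r : R).

(** The inverse of a weight in the extended reals, so that [0^-1 = +oo]. *)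
Definition winv w (x : T) : \bar R := (w x)%:E^-1.

(** The [L^r] norm on [E] of a nonnegative function, without normalization. *)
Definition lpnorm r E f : \bar R := (\int[mu]_(x in E) (f x `^ r)%:E) `^ r^-1.

(** The norm of [w^-1] on [E] in the Lebesgue space of exponent
    [r * (q / r)' = 1 / (1/r - 1/q)], read as [+oo] when [q = r]. *)
Definition dual_norm q r w E : \bar R :=
  if q == r then 'N[mu]_(+oo)[winv w \_ E]
  else let e := (r * conjugate (q / r))%R in
       (\int[mu]_(x in E) (winv w x `^ e)) `^ e^-1.

Lemma inv_dual_exponent q r : (0 < r)%R -> (r < q)%R ->
  ((r * conjugate (q / r))^-1 = r^-1 - q^-1)%R.
Proof.
move=> r0 rq; have q0 := lt_trans r0 rq; have qr : (0 < q - r)%R by rewrite subr_gt0.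
rewrite /conjugate; field; by rewrite mulN1r !gt_eqF.
Qed.

Lemma dual_exponent_gt0 q r : (0 < r)%R -> (r < q)%R ->
  (0 < r * conjugate (q / r))%R.
Proof.
move=> r0 rq; rewrite -invr_gt0 inv_dual_exponent// subr_gt0 ltf_pV2// posrE.
exact: lt_trans rq.
Qed.

Lemma lpnorm_ge0 r E f : 0 <= lpnorm r E f.
Proof. exact: poweR_ge0. Qed.

Lemma winv_ge0 w x : (0 <= w x)%R -> 0 <= winv w x.
Proof. by move=> w0; rewrite /winv inve_ge0 lee_fin. Qed.

Lemma dual_norm_ge0 q r w E : 0 <= dual_norm q r w E.
Proof. by rewrite /dual_norm; case: ifP => _; rewrite ?Lnorm_ge0 ?poweR_ge0. Qed.

Lemma measurable_winv w : measurable_fun [set: T] w ->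
  (forall x, 0 <= w x)%R -> measurable_fun [set: T] (winv w).
Proof.
move=> mw w0; rewrite (_ : winv w = fun x => if w x == 0%R then +oo else
    (w x `^ (-1))%:E).
  apply: measurable_fun_ifT => //; first exact: measurable_fun_eqr.
  apply/measurable_EFinP.
  exact: (@measurableT_comp _ _ _ _ _ _ (@powR R ^~ (-1)%R)).
by apply/funext => x; rewrite /winv inver powR_inv1.
Qed.

Lemma measurable_powRE w r : measurable_fun [set: T] w ->
  measurable_fun [set: T] (fun x => (w x `^ r)%:E).
Proof.
by move=> mw; apply/measurable_EFinP; exact: (@measurableT_comp _ _ _ _ _ _ (@powR R ^~ r)).
Qed.

Lemma lpnorm_le r E f g : (0 <= r)%R -> measurable E ->
  measurable_fun [set: T] f -> measurable_fun [set: T] g ->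
  (\forall x \ae mu, E x -> (0 <= f x <= g x)%R) ->
  lpnorm r E f <= lpnorm r E g.
Proof.
move=> r0 mE mf mg fg; rewrite /lpnorm; apply: gt0_ler_poweR.
- by rewrite invr_ge0.
- by rewrite in_itv/= leey andbT; apply: integral_ge0 => x _; rewrite lee_fin powR_ge0.
- by rewrite in_itv/= leey andbT; apply: integral_ge0 => x _; rewrite lee_fin powR_ge0.
apply: ae_ge0_le_integral => //.
- by move=> x _; rewrite lee_fin powR_ge0.
- by apply: measurable_funTS; exact: measurable_powRE.
- by move=> x _; rewrite lee_fin powR_ge0.
- by apply: measurable_funTS; exact: measurable_powRE.
apply: filterS fg => x /[apply] /andP[f0 fg].
by rewrite lee_fin ge0_ler_powR// nnegrE// (le_trans f0).
Qed.

Lemma lpnormZ r E f (c : R) : (0 < r)%R -> (0 <= c)%R -> measurable E ->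
  measurable_fun [set: T] f -> (forall x, 0 <= f x)%R ->
  lpnorm r E (fun x => f x * c)%R = lpnorm r E f * c%:E.
Proof.
move=> r0 c0 mE mf f0; rewrite /lpnorm.
under eq_integral => x _ do rewrite powRM// mulrC EFinM.
rewrite ge0_integralZl//; last 3 first.
- by apply: measurable_funTS; exact: measurable_powRE.
- by move=> x _; rewrite lee_fin powR_ge0.
- by rewrite lee_fin powR_ge0.
rewrite poweRM ?lee_fin ?powR_ge0//; last first.
  by apply: integral_ge0 => x _; rewrite lee_fin powR_ge0.
by rewrite poweR_EFin -powRrM mulfV ?gt_eqF// powRr1// muleC.
Qed.

Hypothesis muT0 : 0 < mu [set: T].

Lemma dual_norm_infE r w E : (forall x, 0 <= w x)%R ->
  dual_norm r r w E = ess_sup mu (winv w \_ E).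
Proof.
move=> w0; rewrite /dual_norm eqxx unlock muT0; congr ess_sup.
apply/funext => x; rewrite /= gee0_abs// /patch; case: ifP => // _.
exact: winv_ge0.
Qed.

(** Hoelder's inequality for [f = (f w) w^-1].  The product on the right may be of
    the form [0 * +oo = 0], hence the finiteness hypothesis: when the dual norm is
    finite, [w] is positive at almost every point of [E]. *)
Lemma weighted_hoelder q r w E f : (0 < r)%R -> (r <= q)%R -> measurable E ->
  measurable_fun [set: T] w -> (forall x, 0 <= w x)%R ->
  measurable_fun [set: T] f -> (forall x, 0 <= f x)%R ->
  dual_norm q r w E < +oo ->
  lpnorm r E f <= lpnorm q E (fun x => f x * w x)%R * dual_norm q r w E.
Proof.
move=> r0; rewrite le_eqVlt => /predU1P[<-{q}|rq] mE mw w0 mf f0.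
  have D0 := dual_norm_ge0 r r w E.
  rewrite -ge0_fin_numE// => /fineK Dfin.
  set c := fine _ in Dfin; have c0 : (0 <= c)%R by rewrite fine_ge0.
  have mfw : measurable_fun [set: T] (fun x => f x * w x)%R by exact: measurable_funM.
  have fw0 x : (0 <= f x * w x)%R by rewrite mulr_ge0.
  rewrite -Dfin -(lpnormZ r0 c0 mE mfw fw0).
  apply: lpnorm_le => //; [exact: ltW|exact: measurable_funM|].
  have := ess_sup_ge mu (winv w \_ E).
  rewrite -(dual_norm_infE r)// -Dfin; apply: filterS => x wc Ex.
  rewrite f0/= -mulrA ler_peMr//.
  move: wc; rewrite patchE mem_set// /winv inver.
  case: eqP => // /eqP wx; rewrite lee_fin => wc.
  by rewrite -(@mulfV _ (w x))// ler_wpM2l.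
have q0 := lt_trans r0 rq.
rewrite /dual_norm gt_eqF//; set e := (r * conjugate (q / r))%R.
have e0 : (0 < e)%R by exact: dual_exponent_gt0.
have einv : (e^-1 = r^-1 - q^-1)%R by exact: inv_dual_exponent.
clearbody e.
set D := \int[mu]_(x in E) _ => Doo.
have we_ge0 x : 0 <= winv w x `^ e by exact: poweR_ge0.
have mwe : measurable_fun [set: T] (fun x => winv w x `^ e).
  apply: (@measurableT_comp _ _ _ _ _ _ (@poweR R ^~ e)) => //.
    exact: measurable_poweR.
  exact: measurable_winv.
have wn0 : \forall x \ae mu, E x -> w x != 0%R.
  have : mu.-integrable E (fun x => winv w x `^ e).
    apply/integrableP; split; first exact: measurable_funTS.
    under eq_integral => x _ do rewrite gee0_abs//.
    by apply: lty_poweRy Doo; rewrite invr_neq0// gt_eqF.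
  move=> /(integrable_ae mE); apply: filterS => x /[apply].
  by rewrite /winv inver; case: eqP => //; rewrite /= gt_eqF.
have DE : D = \int[mu]_x `|(w x `^ (- r) * \1_E x)%:E| `^ (e / r).
  rewrite /D integral_mkcond; apply: ae_eq_integral => //.
  - apply/measurable_restrict => //; exact: measurable_funTS.
  - apply: (@measurableT_comp _ _ _ _ _ _ (@poweR R ^~ (e / r)%R)) => //.
      exact: measurable_poweR.
    apply: measurableT_comp => //; apply/measurable_EFinP.
    apply: measurable_funM => //.
    exact: (@measurableT_comp _ _ _ _ _ _ (@powR R ^~ (- r)%R)).
  - apply: filterS wn0 => x wn0 _; rewrite patchE indicE.
    case: ifPn => [/set_mem Ex|_]; last first.
      by rewrite /= mulr0 normr0 powR0// mulf_neq0// ?invr_eq0 gt_eqF.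
    have wx := wn0 Ex; rewrite /winv inver (negbTE wx) /= mulr1.
    rewrite ger0_norm ?powR_ge0// -powRrM -(powR_inv1 (w0 x)) -powRrM.
    by congr (powR _ _)%:E; rewrite mulN1r mulNr mulrCA mulfV ?mulr1 ?gt_eqF.
have mF : measurable_fun [set: T] (fun x => (f x * w x) `^ r * \1_E x)%R.
  apply: measurable_funM => //.
  apply: (@measurableT_comp _ _ _ _ _ _ (@powR R ^~ r)) => //.
  exact: measurable_funM.
have mG : measurable_fun [set: T] (fun x => w x `^ (- r) * \1_E x)%R.
  apply: measurable_funM => //.
  exact: (@measurableT_comp _ _ _ _ _ _ (@powR R ^~ (- r)%R)).
have := @hoelder _ _ _ mu _ _ (q / r)%R (e / r)%R mF mG.
rewrite !divr_gt0// => /(_ isT isT).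
have -> : ((q / r)^-1 + (e / r)^-1 = 1)%R.
  by rewrite !invfM invrK einv; field; rewrite !gt_eqF.
move=> /(_ erefl).
set F := (fun x => _ * _)%R in mF *; set G := (fun x => _ * _)%R in mG *.
(* the two factors are (f w)^r and w^-r, with exponents q / r and e / r *)
have -> : 'N[mu]_(e / r)%:E[EFin \o G] = D `^ (e / r)^-1.
  by rewrite DE unlock.
have -> : 'N[mu]_(q / r)%:E[EFin \o F] =
    (\int[mu]_(x in E) ((f x * w x) `^ q)%:E) `^ (q / r)^-1.
  rewrite unlock; apply: (congr1 (fun z => z `^ _)).
  rewrite [RHS]integral_mkcond; apply: eq_integral => x _.
  rewrite /F patchE /= indicE; case: ifPn => [/set_mem Ex|_]; last first.
    by rewrite mulr0 normr0 powR0// mulf_neq0// ?invr_eq0 gt_eqF.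
  rewrite mulr1 ger0_norm ?powR_ge0// -powRrM; congr (powR _ _)%:E.
  by rewrite mulrCA mulfV ?mulr1 ?gt_eqF.
have -> : 'N[mu]_1[EFin \o (F \* G)%R] = \int[mu]_(x in E) (f x `^ r)%:E.
  rewrite Lnorm1 [RHS]integral_mkcond; apply: ae_eq_integral => //.
  - do 2!apply: measurableT_comp => //; exact: measurable_funM.
  - by apply/(measurable_restrict _ _ _) => //; apply: measurable_funTS; exact: measurable_powRE.
  - apply: filterS wn0 => x wn0 _; rewrite /F /G patchE /= indicE.
    case: ifPn => [/set_mem Ex|_]; last by rewrite !mulr0 normr0.
    have wx := wn0 Ex; rewrite !mulr1 ger0_norm ?mulr_ge0 ?powR_ge0//.
    by rewrite powRM// -mulrA -powRD ?wx ?implybT// subrr powRr0 mulr1.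
rewrite /lpnorm => H.
apply: (@le_trans _ _ (((\int[mu]_(x in E) ((f x * w x) `^ q)%:E) `^ (q / r)^-1 *
   D `^ (e / r)^-1) `^ r^-1)).
  apply: gt0_ler_poweR => //; first by rewrite invr_ge0 ltW.
  - by rewrite in_itv/= leey andbT; apply: integral_ge0 => x _; rewrite lee_fin powR_ge0.
  - by rewrite in_itv/= leey andbT mule_ge0 ?poweR_ge0.
rewrite poweRM ?poweR_ge0// -!poweRrM.
have -> : ((q / r)^-1 / r = q^-1)%R by rewrite invfM invrK mulfK ?gt_eqF.
by have -> : ((e / r)^-1 / r = e^-1)%R by rewrite invfM invrK mulfK ?gt_eqF.
Qed.

(** The truncation of [w^-1] at height [m + 1]. *)
Let trunc_inv w (m : nat) (x : T) : R := (Num.max (w x) m.+1%:R^-1 `^ (- 1))%R.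

Let max_trunc_gt0 w m x : (0 < Num.max (w x) m.+1%:R^-1 :> R)%R.
Proof. by rewrite lt_max invr_gt0 ltr0Sn orbT. Qed.

Let trunc_invE w m x : trunc_inv w m x = (Num.max (w x) m.+1%:R^-1)^-1%R.
Proof. by rewrite /trunc_inv powR_inv1// ltW. Qed.

Let trunc_inv_ge0 w m x : (0 <= trunc_inv w m x)%R.
Proof. exact: powR_ge0. Qed.

Let trunc_inv_le w m x : (trunc_inv w m x <= m.+1%:R)%R.
Proof.
rewrite trunc_invE -[leRHS]invrK lef_pV2 ?posrE// ?invr_gt0//.
by rewrite le_max lexx orbT.
Qed.

Let trunc_inv_mul w m x : (trunc_inv w m x * w x <= 1)%R.
Proof. by rewrite trunc_invE mulrC ler_pdivrMr// mul1r le_max lexx. Qed.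

Let nd_trunc_inv w x m p : (m <= p)%N -> (trunc_inv w m x <= trunc_inv w p x)%R.
Proof.
move=> mp; rewrite !trunc_invE lef_pV2 ?posrE//.
by rewrite ge_max !le_max lexx/= lef_pV2 ?posrE// ler_nat ltnS mp orbT.
Qed.

Let measurable_trunc_inv w m : measurable_fun [set: T] w ->
  measurable_fun [set: T] (trunc_inv w m).
Proof.
move=> mw; apply: (@measurableT_comp _ _ _ _ _ _ (@powR R ^~ (- 1)%R)) => //.
exact: measurable_maxr.
Qed.

Let winv_le_lim w e x : (0 < e)%R -> (0 <= w x)%R ->
  winv w x `^ e <= limn (fun m => (trunc_inv w m x `^ e)%:E).
Proof.
move=> e0 w0.
have nd : {homo (fun m => (trunc_inv w m x `^ e)%:E) : m p / (m <= p)%N >-> m <= p}.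
  by move=> m p mp; rewrite lee_fin ge0_ler_powR ?(ltW e0) ?nnegrE// nd_trunc_inv.
rewrite (cvg_lim _ (ereal_nondecreasing_cvgn nd))//.
rewrite /winv inver; case: eqP => [wx|/eqP wx].
  rewrite (_ : ereal_sup _ = +oo) ?leey//; apply/eq_infty => A.
  pose m := Num.truncn (`|A| `^ e^-1)%R.
  apply: (@le_trans _ _ (trunc_inv w m x `^ e)%:E); last first.
    by apply: ereal_sup_ubound; exists m.
  rewrite trunc_invE wx max_r ?invr_ge0// invrK lee_fin.
  apply: (le_trans (ler_norm _)).
  have -> : (`|A| = (`|A| `^ e^-1) `^ e)%R by rewrite -powRrM mulVf ?gt_eqF// powRr1.
  rewrite ge0_ler_powR ?(ltW e0) ?nnegrE ?powR_ge0 ?ltW//.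
  exact: Num.Theory.truncnS_gt.
pose m := Num.truncn (w x)^-1%R.
apply: (@le_trans _ _ (trunc_inv w m x `^ e)%:E); last first.
  by apply: ereal_sup_ubound; exists m.
have wx0 : (0 < w x)%R by rewrite lt_def wx.
rewrite trunc_invE max_l// -[leRHS]invrK lef_pV2 ?posrE ?invr_gt0//.
by rewrite ltW// Num.Theory.truncnS_gt.
Qed.

(** Near-extremizers of the weighted Hoelder inequality, before normalization:
    a truncation of [w^-1] raised to a suitable power when [r < q], an indicator
    function when [q = r]. *)
Let dual_norm_approx q r w E (N : R) : (0 < r)%R -> (r <= q)%R -> measurable E ->
  mu E < +oo -> measurable_fun [set: T] w -> (forall x, 0 <= w x)%R ->
  (0 < N)%R -> N%:E < dual_norm q r w E ->
  exists f (a b : R), [/\ measurable_fun [set: T] f,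
    forall x, (0 <= f x)%R & forall x, ~ E x -> f x = 0%R] /\
    [/\ lpnorm r E f = a%:E, lpnorm q E (fun x => f x * w x)%R <= b%:E, (0 < b)%R &
    (N * b < a)%R].
Proof.
move=> r0; rewrite le_eqVlt => /predU1P[<-{q}|rq] mE Eoo mw w0 N0.
  move=> /lte_real_between[N1 N_N1]; rewrite dual_norm_infE// => N1D.
  have N10 := lt_trans N0 N_N1.
  (* a set of positive measure, by definition of the essential supremum *)
  pose A := E `&` [set x | N1%:E < winv w x].
  have mA : measurable A.
    by apply: emeasurable_fun_o_infty => //; apply: measurable_funTS; exact: measurable_winv.
  have Aoo : mu A < +oo by apply: le_lt_trans Eoo; apply: le_measure; rewrite ?inE// => x [].
  have muA0 : 0 < mu A.
    rewrite lt0e measure_ge0 andbT; apply/eqP => muA0; move: N1D; apply/negP.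
    rewrite -leNgt; apply/ess_supP; exists A; split => // x /= /negP.
    rewrite -ltNge patchE; case: ifPn => [/set_mem Ex N1w|_]; first by [].
    by rewrite lte_fin ltNge ltW.
  have /fineK muAE : mu A \is a fin_num by rewrite ge0_fin_numE// ltW.
  have muAr0 : (0 < fine (mu A))%R by rewrite fine_gt0// muA0.
  have AEA : A `&` E = A by apply/setIidPl => x [].
  have indE : \int[mu]_(x in E) (\1_A x `^ r)%:E = (fine (mu A))%:E.
    rewrite muAE -[in RHS]AEA -integral_indic//; apply: eq_integral => x _.
    by rewrite indicE; case: (x \in A); rewrite ?powR1 ?powR0 ?gt_eqF.
  exists \1_A, (fine (mu A) `^ r^-1)%R, (fine (mu A) `^ r^-1 / N1)%R; split; split.
  - exact: measurable_indic.
  - by move=> x; rewrite indicE.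
  - by move=> x Ex; rewrite indicE memNset// => -[].
  - by rewrite /lpnorm indE.
  - apply: (@le_trans _ _ (lpnorm r E (fun x => \1_A x * N1^-1)%R)).
      apply: lpnorm_le => //; first exact: ltW.
      + exact: measurable_funM.
      + exact: measurable_funM.
      apply: nearW => x Ex; rewrite mulr_ge0//= indicE.
      case: (boolP (x \in A)) => [/set_mem[_ /=]|_]; last by rewrite !mul0r.
      rewrite !mul1r /winv inver; case: eqP => [->|/eqP wx]; first by rewrite invr_ge0 ltW.
      rewrite lte_fin => N1w; rewrite -[leLHS]invrK lef_pV2 ?posrE ?invr_gt0 ?ltW//.
      by rewrite lt_def wx w0.
    by rewrite lpnormZ ?invr_ge0 ?(ltW N10)// /lpnorm indE.
  - by rewrite divr_gt0// powR_gt0.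
  - by rewrite mulrCA gtr_pMr ?powR_gt0// ltr_pdivrMr// mul1r.
have q0 := lt_trans r0 rq.
rewrite /dual_norm gt_eqF//; set e := (r * conjugate (q / r))%R.
have e0 : (0 < e)%R by exact: dual_exponent_gt0.
have einv : (e^-1 = r^-1 - q^-1)%R by exact: inv_dual_exponent.
clearbody e => /= ND.
pose I m := \int[mu]_(x in E) (trunc_inv w m x `^ e)%:E.
have mI m : measurable_fun E (fun x => (trunc_inv w m x `^ e)%:E).
  by apply: measurable_funTS; apply: measurable_powRE; exact: measurable_trunc_inv.
have I0 m : 0 <= I m by apply: integral_ge0 => x _; rewrite lee_fin powR_ge0.
have Ioo m : I m < +oo.
  apply: (@le_lt_trans _ _ (\int[mu]_(x in E) (m.+1%:R `^ e)%:E)).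
    apply: ge0_le_integral => //.
    - by move=> x _; rewrite lee_fin powR_ge0.
    - by move=> x _; rewrite lee_fin ge0_ler_powR ?nnegrE// ?(ltW e0).
  by rewrite integral_cst// lte_mul_pinfty// lee_fin powR_ge0.
have ndI : nondecreasing_seq I.
  move=> m p mp; apply: ge0_le_integral; [exact: mE| |exact: mI|exact: mI|].
    by move=> x _; rewrite lee_fin powR_ge0.
  by move=> x _; rewrite lee_fin ge0_ler_powR ?(ltW e0) ?nnegrE// nd_trunc_inv.
have [m Nm] : exists m, (N `^ e)%:E < I m.
  apply: contrapT => /forallNP Nlt.
  have : \int[mu]_(x in E) (winv w x `^ e) <= (N `^ e)%:E.
    apply: (@le_trans _ _ (\int[mu]_(x in E)
        limn (fun m => (trunc_inv w m x `^ e)%:E))).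
      apply: ge0_le_integral => //.
      - by move=> x _; exact: poweR_ge0.
      - apply: measurable_funTS.
        apply: (@measurableT_comp _ _ _ _ _ _ (@poweR R ^~ e)) => //.
          exact: measurable_poweR.
        exact: measurable_winv.
      - apply: (emeasurable_fun_cvg (fun m x => (trunc_inv w m x `^ e)%:E)) => // x _.
        apply: ereal_nondecreasing_is_cvgn => m p mp.
        by rewrite lee_fin ge0_ler_powR ?(ltW e0) ?nnegrE// nd_trunc_inv.
      - by move=> x _; exact: winv_le_lim.
    rewrite monotone_convergence//; last 2 first.
    - by move=> m x _; rewrite lee_fin powR_ge0.
    - by move=> x _ m p mp; rewrite lee_fin ge0_ler_powR ?(ltW e0) ?nnegrE// nd_trunc_inv.
    apply: lime_le; first exact: ereal_nondecreasing_is_cvgn ndI.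
    by apply: nearW => m; rewrite leNgt; apply/negP/Nlt.
  move=> DN.
  have : (\int[mu]_(x in E) (winv w x `^ e)) `^ e^-1 <= (N `^ e)%:E `^ e^-1.
    apply: gt0_ler_poweR DN; rewrite ?invr_ge0 ?(ltW e0)// in_itv/= leey andbT ?lee_fin ?powR_ge0//.
    by apply: integral_ge0 => x _; exact: poweR_ge0.
  by rewrite poweR_EFin -powRrM mulfV ?gt_eqF// powRr1 ?(ltW N0)// leNgt ND.
have /fineK IE : I m \is a fin_num by rewrite ge0_fin_numE.
set J := fine (I m) in IE.
have NJ : (N `^ e < J)%R by rewrite -lte_fin IE.
have J0 : (0 < J)%R by apply: lt_trans NJ; rewrite powR_gt0.
exists (fun x => trunc_inv w m x `^ (e / r) * \1_E x)%R, (J `^ r^-1)%R, (J `^ q^-1)%R.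
have mf : measurable_fun [set: T] (fun x => trunc_inv w m x `^ (e / r) * \1_E x)%R.
  apply: measurable_funM => //.
  apply: (@measurableT_comp _ _ _ _ _ _ (@powR R ^~ (e / r)%R)) => //.
  exact: measurable_trunc_inv.
have u0 x : (0 < trunc_inv w m x)%R by rewrite powR_gt0.
split; split => //.
- by move=> x; rewrite mulr_ge0// powR_ge0.
- by move=> x Ex; rewrite indicE memNset// mulr0.
- have -> : (J `^ r^-1)%:E = I m `^ r^-1 by rewrite -IE.
  apply: (congr1 (fun z => z `^ _)); apply: eq_integral => x Ex.
  by rewrite indicE Ex mulr1 -powRrM mulfVK// gt_eqF.
- have -> : (J `^ q^-1)%:E = I m `^ q^-1 by rewrite -IE.
  apply: (@le_trans _ _ (lpnorm q E (fun x => trunc_inv w m x `^ (e / q))%R)).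
    apply: lpnorm_le => //; first exact: ltW.
    + exact: measurable_funM.
    + apply: (@measurableT_comp _ _ _ _ _ _ (@powR R ^~ (e / q)%R)) => //.
      exact: measurable_trunc_inv.
    apply: nearW => x Ex; rewrite !mulr_ge0 ?powR_ge0//= indicE mem_set// mulr1.
    (* this identity of exponents turns w * w^-1 <= 1 into the bound *)
    have -> : (e / r = e / q + 1)%R.
      have -> : (r^-1 = e^-1 + q^-1)%R by rewrite einv subrK.
      by rewrite mulrDr mulfV ?gt_eqF// addrC.
    rewrite powRD ?gt_eqF ?addr_gt0 ?divr_gt0// (powRr1 (ltW (u0 x))) -mulrA ler_piMr ?powR_ge0//.
  have HI : \int[mu]_(x in E) ((trunc_inv w m x `^ (e / q)) `^ q)%:E = I m.
    by apply: eq_integral => x _; rewrite -powRrM mulfVK// gt_eqF.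
  by rewrite /lpnorm HI.
- by rewrite powR_gt0.
- have -> : (J `^ r^-1 = J `^ e^-1 * J `^ q^-1)%R.
    by rewrite -powRD ?(gt_eqF J0) ?implybT// einv subrK.
  rewrite ltr_pM2r ?powR_gt0//.
  have {1}-> : (N = (N `^ e) `^ e^-1)%R by rewrite -powRrM mulfV ?gt_eqF// powRr1 ?(ltW N0).
  by rewrite gt0_ltr_powR ?invr_gt0// nnegrE ?powR_ge0 ?(ltW NJ) ?(ltW J0).
Qed.

(** The constant of [weighted_hoelder] is optimal, with near-extremizers normalized
    so that their [L^r] norm exceeds [1]. *)
Lemma weighted_hoelder_sharp q r w E (N : R) : (0 < r)%R -> (r <= q)%R ->
  measurable E -> mu E < +oo ->
  measurable_fun [set: T] w -> (forall x, 0 <= w x)%R ->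
  (0 < N)%R -> N%:E < dual_norm q r w E ->
  exists f, [/\ measurable_fun [set: T] f,
    forall x, (0 <= f x)%R & forall x, ~ E x -> f x = 0%R] /\
    1 < lpnorm r E f /\ lpnorm q E (fun x => f x * w x)%R <= (N^-1)%:E.
Proof.
move=> r0 rq mE Eoo mw w0 N0 ND.
have [f [a [b [[mf f0 fE] [fa fwb b0 Nba]]]]] := dual_norm_approx r0 rq mE Eoo mw w0 N0 ND.
have q0 := lt_le_trans r0 rq.
have c0 : (0 < (N * b)^-1)%R by rewrite invr_gt0 mulr_gt0.
exists (fun x => f x * (N * b)^-1)%R; split; [split|split].
- exact: measurable_funM.
- by move=> x; rewrite mulr_ge0// ltW.
- by move=> x /fE ->; rewrite mul0r.
- by rewrite lpnormZ ?(ltW c0)// fa -EFinM lte_fin ltr_pdivlMr ?mul1r// mulr_gt0.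
- rewrite (_ : (fun x => _) = fun x => f x * w x * (N * b)^-1)%R; last first.
    by apply/funext => x; rewrite mulrAC.
  rewrite lpnormZ ?(ltW c0)//; last by move=> x; rewrite mulr_ge0.
    apply: (@le_trans _ _ (b%:E * (N * b)^-1%:E)).
      by rewrite lee_wpmul2r// lee_fin ltW.
    by rewrite -EFinM lee_fin invfM mulrCA mulfV ?gt_eqF// mulr1.
  exact: measurable_funM.
Qed.

Lemma int_powR_ge0 r E f : 0 <= \int[mu]_(x in E) (f x `^ r)%:E.
Proof. by apply: integral_ge0 => x _; rewrite lee_fin powR_ge0. Qed.

Lemma lpnorm_poweR r E f : (0 < r)%R ->
  lpnorm r E f `^ r = \int[mu]_(x in E) (f x `^ r)%:E.
Proof. by move=> r0; rewrite /lpnorm poweRVK ?gt_eqF// int_powR_ge0. Qed.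

Lemma lpnorm_subset r E F f : (0 < r)%R -> measurable E -> measurable F ->
  measurable_fun [set: T] f -> E `<=` F -> lpnorm r E f <= lpnorm r F f.
Proof.
move=> r0 mE mF mf EF; apply: le_poweR; rewrite ?invr_ge0 ?(ltW r0) ?int_powR_ge0//.
apply: ge0_subset_integral => //; first by apply: measurable_funTS; exact: measurable_powRE.
by move=> x _; rewrite lee_fin powR_ge0.
Qed.

(** A function which vanishes off [E] has all of its norm on [E]. *)
Lemma lpnorm_supp r Q E f : (0 < r)%R -> measurable Q -> measurable E ->
  measurable_fun [set: T] f -> (forall x, ~ E x -> f x = 0%R) ->
  lpnorm r Q f <= lpnorm r E f.
Proof.
move=> r0 mQ mE mf fE; have -> : lpnorm r E f = lpnorm r setT f.
  rewrite /lpnorm integral_mkcond; congr (_ `^ _); apply: eq_integral => x _.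
  rewrite patchE; case: ifPn => // /negP Ex; rewrite fE ?powR0 ?gt_eqF// => /mem_set.
  exact: Ex.
exact: lpnorm_subset.
Qed.

Lemma lpnorm_eq0 r Q f : (0 < r)%R -> (forall x, Q x -> f x = 0%R) ->
  lpnorm r Q f = 0.
Proof.
move=> r0 fQ; rewrite /lpnorm (eq_integral (cst 0)).
  by rewrite integral0 poweR0r// invr_neq0// gt_eqF.
by move=> x /set_mem Qx; rewrite fQ// powR0// gt_eqF.
Qed.

(** Subadditivity of the [r]-th power of the dual norm, obtained from duality so
    that the essential supremum and the integral are treated alike. *)
Lemma dual_norm_subadd q r w E F : (0 < r)%R -> (r <= q)%R ->
  measurable E -> mu E < +oo -> measurable F -> mu F < +oo -> [disjoint E & F] ->
  measurable_fun [set: T] w -> (forall x, 0 <= w x)%R ->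
  dual_norm q r w (E `|` F) `^ r <= dual_norm q r w E `^ r + dual_norm q r w F `^ r.
Proof.
move=> r0 rq mE Eoo mF Foo EF mw w0; have q0 := lt_le_trans r0 rq.
have D0 (E' : set T) : 0 <= dual_norm q r w E' by exact: dual_norm_ge0.
have Dr0 E' : 0 <= dual_norm q r w E' `^ r by exact: poweR_ge0.
have [DE|DEoo] := eqVneq (dual_norm q r w E) +oo.
  by rewrite DE poweRyr ?gt_eqF// addye ?leey// -ltNye (lt_le_trans _ (Dr0 F)).
have [DF|DFoo] := eqVneq (dual_norm q r w F) +oo.
  by rewrite DF poweRyr ?gt_eqF// addey ?leey// -ltNye (lt_le_trans _ (Dr0 E)).
rewrite leNgt; apply/negP => lt_D.
set S := _ + _ in lt_D.
have S0 : 0 <= S by rewrite adde_ge0.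
have Soo : S < +oo by rewrite lte_add_pinfty// poweR_lty// ltey.
have {}lt_D : S `^ r^-1 < dual_norm q r w (E `|` F).
  rewrite ltNge; apply/negP => /(le_poweR (ltW r0) (D0 _)).
  by rewrite poweRVK ?gt_eqF// leNgt lt_D.
have Sr_fin : S `^ r^-1 \is a fin_num by rewrite ge0_fin_numE ?poweR_ge0 ?poweR_lty.
move: lt_D; rewrite -(fineK Sr_fin) => /lte_real_between[N SN ND].
have N0 : (0 < N)%R by apply: le_lt_trans SN; rewrite fine_ge0 ?poweR_ge0.
have [||f [[mf f0 _] [f1 fN]]] := weighted_hoelder_sharp r0 rq _ _ mw w0 N0 ND.
  exact: measurableU.
  by rewrite (le_lt_trans (measureU2 _ _ _))// lte_add_pinfty.
have mfw : measurable_fun [set: T] (fun x => f x * w x)%R by exact: measurable_funM.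
have part E' : measurable E' -> E' `<=` E `|` F -> dual_norm q r w E' != +oo ->
    \int[mu]_(x in E') (f x `^ r)%:E <= (N^-1 `^ r)%:E * dual_norm q r w E' `^ r.
  move=> mE' sE' E'oo; rewrite -lpnorm_poweR// -poweR_EFin -poweRM//; last first.
    by rewrite lee_fin invr_ge0 ltW.
  apply: le_poweR; rewrite ?(ltW r0) ?lpnorm_ge0//.
  apply: (le_trans (weighted_hoelder r0 rq mE' mw w0 mf f0 _)); first by rewrite ltey.
  rewrite lee_wpmul2r//; apply: le_trans fN; apply: lpnorm_subset => //.
  exact: measurableU.
move: f1; rewrite ltNge => /negP; apply.
rewrite -(@poweR1r _ r^-1); apply: le_poweR; rewrite ?invr_ge0 ?(ltW r0) ?int_powR_ge0//.
rewrite ge0_integral_setU//; last 2 first.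
- by apply: measurable_funTS; exact: measurable_powRE.
- by move=> x _; rewrite lee_fin powR_ge0.
apply: (@le_trans _ _ ((N^-1 `^ r)%:E * S)).
  by rewrite ge0_muleDr//; apply: leeD; apply: part.
apply: (@le_trans _ _ ((N^-1 `^ r)%:E * (N `^ r)%:E)).
  rewrite lee_wpmul2l ?lee_fin ?powR_ge0// -poweR_EFin -[leLHS](@poweRVK _ r) ?gt_eqF//.
  by apply: le_poweR; rewrite ?(ltW r0) ?poweR_ge0// -(fineK Sr_fin) lee_fin ltW.
rewrite -EFinM lee_fin -powRM ?invr_ge0 ?(ltW N0)//.
by rewrite mulVf ?gt_eqF// powR1.
Qed.

(** Adding a piece either increases the dual norm by a factor at most [b], or the
    piece already carries a fixed fraction of the dual norm. *)
Lemma dual_norm_dichotomy q r w E F (b : R) : (0 < r)%R -> (r <= q)%R ->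
  measurable E -> mu E < +oo -> measurable F -> mu F < +oo -> [disjoint E & F] ->
  measurable_fun [set: T] w -> (forall x, 0 <= w x)%R -> (1 < b)%R ->
  dual_norm q r w (E `|` F) <= b%:E * dual_norm q r w E \/
  dual_norm q r w (E `|` F) <=
    ((1 + (b `^ r - 1)^-1) `^ r^-1)%:E * dual_norm q r w F.
Proof.
move=> r0 rq mE Eoo mF Foo EF mw w0 b1.
have := dual_norm_subadd r0 rq mE Eoo mF Foo EF mw w0.
have D0 (E' : set T) : 0 <= dual_norm q r w E' by exact: dual_norm_ge0.
have Dr0 E' : 0 <= dual_norm q r w E' `^ r by exact: poweR_ge0.
have b0 : (0 < b)%R by rewrite (lt_trans _ b1).
have e0 : (0 < b `^ r - 1)%R.
  rewrite subr_gt0; have {1}<- : (1 `^ r = 1 :> R)%R by rewrite powR1.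
  by rewrite gt0_ltr_powR// nnegrE ltW.
move=> Dsub; have [le_DF|/ltW lt_DF] :=
  leP (dual_norm q r w F `^ r) ((b `^ r - 1)%:E * dual_norm q r w E `^ r).
- left; apply: (le_poweR_inj r0) => //; first by rewrite mule_ge0// lee_fin ltW.
  rewrite poweRM ?lee_fin ?(ltW b0)//; apply: (le_trans Dsub).
  apply: (le_trans (leeD2l _ le_DF)).
  rewrite -[X in X + _]mul1e -ge0_muleDl ?lee_fin ?(ltW e0)//.
  by rewrite -EFinD addrC subrK.
- right; have C0 : (0 <= 1 + (b `^ r - 1)^-1)%R by rewrite addr_ge0// invr_ge0 ltW.
  apply: (le_poweR_inj r0) => //; first by rewrite mule_ge0// lee_fin powR_ge0.
  rewrite poweRM ?lee_fin ?powR_ge0// poweR_EFin -powRrM mulVf ?gt_eqF// powRr1//.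
  apply: (le_trans Dsub); rewrite EFinD ge0_muleDl ?lee_fin ?invr_ge0 ?(ltW e0)//.
  rewrite mul1e addeC leeD2l// -(@lee_pmul2l _ (b `^ r - 1)%:E)//.
  by rewrite muleA -EFinM mulfV ?gt_eqF// mul1e.
Qed.

Lemma dual_norm_gt0 q r w E : (0 < r)%R -> (r <= q)%R -> measurable E -> 0 < mu E ->
  measurable_fun [set: T] w -> (forall x, 0 <= w x)%R -> 0 < dual_norm q r w E.
Proof.
move=> r0 rq mE E0 mw w0; rewrite lt0e dual_norm_ge0 andbT; apply/eqP => D0.
have := @weighted_hoelder q r w E (cst 1%R) r0 rq mE mw w0.
rewrite D0 mule0 => /(_ (measurable_cst _) (fun=> ler01) (ltry _)).
rewrite /lpnorm (eq_integral (cst 1)); last by move=> x _; rewrite /= powR1.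
by rewrite integral_cst// mul1e leNgt poweR_gt0.
Qed.

End weighted_norms.

(** * Dyadic cubes *)

Section boxes.
Context {R : realType}.

(** The half-open box with lower corner [a] and upper corner [b]. *)
Definition box n (a b : 'I_n -> R) : set (n.-tuple (measurableTypeR R)) :=
  [set x | forall i, a i <= tnth x i < b i].

Lemma measurable_box n (a b : 'I_n -> R) : measurable (box a b).
Proof.
rewrite (_ : box a b = \bigcap_(i in [set: 'I_n])
    ((fun x : n.-tuple (measurableTypeR R) => tnth x i) @^-1` `[a i, b i[%classic)).
  apply: fin_bigcap_measurable => // i _.
  rewrite -[X in measurable X]setTI.
  exact: (@measurable_tnth _ (measurableTypeR R) n i measurableT _ (measurable_itv _)).
apply/seteqP; split => x /= h i; last by move: (h i I); rewrite /= in_itv.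
by move=> _; rewrite /= in_itv/=; exact: h.
Qed.

Lemma borel_lebesgue_box n (a b : 'I_n -> R) : (forall i, a i <= b i) ->
  borel_lebesgue R n (box a b) = (\prod_i (b i - a i))%:E.
Proof.
elim: n a b => [|n IHn] a b ab.
  by rewrite big_ord0 /= diracE mem_set// => -[].
rewrite /= /cons_measure /pushforward.
have -> : cons_pair @^-1` box a b = `[a ord0, b ord0[%classic `*`
    box (fun i => a (lift ord0 i)) (fun i => b (lift ord0 i)).
  apply/seteqP; split => [[x y] h|[x y] [/= hx hy]]; rewrite /box /=.
    split => /=.
      by have := h ord0; rewrite (tnth_nth 0)/= in_itv.
    by move=> i; have := h (lift ord0 i); rewrite !(tnth_nth 0).
  move=> i; case: (unliftP ord0 i) => [j ->|->].
    by have := hy j; rewrite !(tnth_nth 0).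
  by move: hx; rewrite (tnth_nth 0) /= in_itv.
rewrite product_measure1E//; last exact: measurable_box.
rewrite IHn; last by [].
rewrite big_ord_recl EFinM; congr (_ * _)%E.
apply: (etrans (lebesgue_measure_itv `[a ord0, b ord0[)); rewrite /= lte_fin.
by case: ltgtP (ab ord0) => // -> _; rewrite subrr.
Qed.

Lemma measurable_Rn n (A : set (n.-tuple (measurableTypeR R))) : measurable A ->
  measurable (A : set (Rn R n)).
Proof. by move=> mA; apply: sub_caratheodory; exact: sub_sigma_algebra. Qed.

Lemma lebn_box n (a b : 'I_n -> R) : (forall i, a i <= b i) ->
  lebn R n (box a b) = (\prod_i (b i - a i))%:E.
Proof.
by move=> ab; rewrite -borel_lebesgue_box//; apply: measurable_mu_extE; exact: measurable_box.
Qed.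

End boxes.

Section dyadic_cubes.
Context {R : realType} {n : nat}.
Implicit Types (k l : int) (m : 'I_n -> int) (x : Rn R n).

(** The dyadic cube of level [k] and index [m]; larger levels are smaller cubes. *)
Definition cube k m : set (Rn R n) := [set x | forall i,
  (2 : R) ^ (- k) * (m i)%:~R <= tnth x i < 2 ^ (- k) * ((m i)%:~R + 1)].

(** The dyadic cube of level [k] which contains [x]. *)
Definition cube_at k x : set (Rn R n) :=
  cube k (fun i => Num.floor (2 ^ k * (tnth x i : R))).

(** The volume of the cubes of level [k], see [lebn_cube]. *)
Definition cube_vol k : R := (2 ^ (- k)) ^+ n.

Lemma cube_vol_gt0 k : 0 < cube_vol k.
Proof. by rewrite exprn_gt0// exprz_gt0. Qed.

Lemma cube_vol_pred k : cube_vol (k - 1) = 2 ^+ n * cube_vol k.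
Proof. by rewrite /cube_vol -exprMn opprB exprzDr ?unitfE// expr1z. Qed.

Lemma cube_vol_anti k l : l <= k -> cube_vol k <= cube_vol l.
Proof.
move=> lk; rewrite /cube_vol lerXn2r// ?nnegrE ?exprz_ge0//.
by rewrite ler_weXz2l ?lerN2// ler1n.
Qed.

Lemma mem_cube k m x : cube k m x <->
  forall i, (m i)%:~R <= 2 ^ k * (tnth x i : R) < (m i)%:~R + 1.
Proof.
have k0 : 0 < (2 : R) ^ k by rewrite exprz_gt0.
by split=> h i; move: (h i); rewrite -invr_expz ler_pdivrMl// ltr_pdivlMl.
Qed.

Lemma measurable_cube k m : measurable (cube k m).
Proof.
exact: (measurable_Rn (measurable_box (fun i => 2 ^ (- k) * (m i)%:~R)
  (fun i => 2 ^ (- k) * ((m i)%:~R + 1)))).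
Qed.

Lemma lebn_cube k m : lebn R n (cube k m) = (cube_vol k)%:E.
Proof.
rewrite [LHS]lebn_box; last first.
  by move=> i; rewrite ler_wpM2l ?exprz_ge0// lerDl.
congr _%:E; rewrite (eq_bigr (fun=> 2 ^ (- k))); last first.
  by move=> i _; rewrite -mulrBr addrAC subrr add0r mulr1.
by rewrite prodr_const card_ord.
Qed.

Lemma cube_nonempty k m : exists x, cube k m x.
Proof.
exists ([tuple ((2 : R) ^ (- k) * (m i)%:~R) | i < n] : n.-tuple _) => i.
by rewrite tnth_mktuple lexx/= ltr_pM2l ?exprz_gt0// ltrDl.
Qed.

Lemma cube_at_mem k x : cube_at k x x.
Proof.
apply/mem_cube => i; have /andP[-> ] := Num.Theory.floor_itv (2 ^ k * (tnth x i : R)).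
by rewrite intrD.
Qed.

Lemma cube_at_uniq k m x : cube k m x ->
  m = (fun i => Num.floor (2 ^ k * (tnth x i : R))).
Proof.
move=> /mem_cube h; apply/funext => i; apply/esym/Num.Theory.floor_def.
by rewrite intrD; exact: h.
Qed.

Lemma cube_atE k m x : cube k m x -> cube k m = cube_at k x.
Proof. by rewrite /cube_at => /cube_at_uniq {1}->. Qed.

(** A cube which meets a cube of smaller or equal level is contained in it. *)
Lemma cube_nested k l m m' x : l <= k -> cube k m x -> cube l m' x ->
  cube k m `<=` cube l m'.
Proof.
move=> lk /mem_cube hk /mem_cube hl y /mem_cube hy; apply/mem_cube => i.
have [d kE] : exists d : nat, k = l + d%:Z by exists `|k - l|%N; lia.
have scale (z : Rn R n) : (2 : R) ^ k * (tnth z i : R) = (2 ^ d)%:R * (2 ^ l * (tnth z i : R)).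
  by rewrite kE exprzDr ?unitfE// natrX -exprnP [RHS]mulrCA mulrA.
have d0 : (0 : R) < (2 ^ d)%:R by rewrite ltr0n expn_gt0.
move: (hk i) (hl i) (hy i); rewrite !scale => /andP[k1 k2] /andP[l1 l2] /andP[y1 y2].
have le1 : ((2 ^ d)%:Z * m' i <= m i)%R.
  rewrite -ltzD1 -(ltr_int R) intrD intrM; apply: le_lt_trans k2.
  by rewrite -pmulrn ler_pM2l.
have le2 : (m i + 1 <= (2 ^ d)%:Z * (m' i + 1))%R.
  rewrite lezD1 -(ltr_int R) intrM intrD; apply: (le_lt_trans k1).
  by rewrite -pmulrn ltr_pM2l.
move: le1 le2; rewrite -!(ler_int R) !intrM !intrD -!pmulrn => le1 le2.
rewrite -(ler_pM2l d0) (le_trans le1 y1)/=.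
by rewrite -(ltr_pM2l d0) (lt_le_trans y2 le2).
Qed.

Lemma cube_at_sub k l x : l <= k -> cube_at k x `<=` cube_at l x.
Proof. by move=> lk; apply: cube_nested lk (cube_at_mem _ _) (cube_at_mem _ _). Qed.

Lemma dyadic_cube k m : dyadic (cube k m).
Proof. by exists k, m. Qed.

End dyadic_cubes.

Section dyadic_covering.
Local Open Scope ereal_scope.
Context {R : realType} {n : nat}.
Local Notation mu := (lebn R n).
Local Notation idx := (int * {ffun 'I_n -> int})%type.
(* a family of cubes, indexed by level and position, of levels bounded below *)
Variables (P : set idx) (k0 : int).
Hypothesis P_level : forall c, P c -> (k0 <= c.1)%R.

Let fcube (c : idx) : set (Rn R n) := cube c.1 c.2.

(** The cubes of the family which are not contained in a larger one. *)
Let maximal_idx : set idx :=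
  [set c | P c /\ forall c', P c' -> fcube c `<=` fcube c' -> (c.1 <= c'.1)%R].

(** The maximal cubes enumerated by [nat], with empty sets as padding.  Distinct
    indices give disjoint sets. *)
Let max_cube (i : nat) : set (Rn R n) :=
  if pickle_inv i is Some c then (if `[< maximal_idx c >] then fcube c else set0)
  else set0.

Let max_cubeP i x : max_cube i x ->
  exists c, [/\ maximal_idx c, fcube c x, pickle c = i & max_cube i = fcube c].
Proof.
rewrite /max_cube; case ci : (pickle_inv i) => [c|//].
case: asboolP => // mc cx; exists c; split => //.
by have := @pickle_invK idx i; rewrite /oapp ci.
Qed.

Let measurable_max_cube i : measurable (max_cube i).
Proof.
rewrite /max_cube; case: (pickle_inv i) => [c|//].
by case: ifP => // _; exact: measurable_cube.
Qed.

Let trivIset_max_cube : trivIset setT max_cube.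
Proof.
apply/trivIsetP => i j _ _; apply: contraNeq => /set0P[x []].
move=> /max_cubeP[[k m] [[Pc maxc] cx <- _]] /max_cubeP[[k' m'] [[Pc' maxc'] cx' <- _]].
have kk' : k = k'.
  apply/le_anti/andP; split; rewrite leNgt; apply/negP => k'k.
    by have := maxc _ Pc' (cube_nested (ltW k'k) cx cx'); rewrite /= leNgt k'k.
  by have := maxc' _ Pc (cube_nested (ltW k'k) cx' cx); rewrite /= leNgt k'k.
rewrite -kk' in cx' *.
suff -> : m = m' by [].
by apply/ffunP => a; have /= -> := cube_at_uniq cx; have /= -> := cube_at_uniq cx'.
Qed.

(** A point of the union lies in a cube of the family of smallest level, which is
    maximal. *)
Lemma bigcup_maximal : \bigcup_(c in P) fcube c = \bigcup_i max_cube i.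
Proof.
apply/seteqP; split => [x [c Pc cx]|x [i _ /max_cubeP[c [[Pc _] cx _ _]]]]; last first.
  by exists c.
pose lev (d : nat) := `[< exists c, [/\ P c, fcube c x & c.1 = (k0 + d%:Z)%R] >].
have ex_lev : exists d, lev d.
  exists `|c.1 - k0|%N; apply/asboolP; exists c; split => //.
  by have := P_level Pc; lia.
case: (ex_minnP ex_lev) => d /asboolP[c' [Pc' c'x c'd]] dmin.
exists (pickle c'); first exact: I.
rewrite /max_cube pickleK_inv.
case: asboolP => // -[]; split => // c'' Pc'' sub.
rewrite c'd; have := P_level Pc'' => kc''.
suff : (d <= `|c''.1 - k0|)%N by move: kc''; clear; lia.
apply: dmin; apply/asboolP; exists c''; split => //; first exact: sub.
by move: kc''; clear; lia.
Qed.

Lemma measurable_bigcup_cube : measurable (\bigcup_(c in P) fcube c).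
Proof. by rewrite bigcup_maximal; exact: bigcup_measurable. Qed.

(** An inequality between integrals over each cube of a family passes to the
    union, even though the cubes overlap: the maximal ones are disjoint. *)
Lemma dyadic_covering (f g : Rn R n -> \bar R) :
  measurable_fun [set: Rn R n] f -> measurable_fun [set: Rn R n] g ->
  (forall x, 0 <= f x) -> (forall x, 0 <= g x) ->
  (forall c, P c -> \int[mu]_(x in fcube c) f x <= \int[mu]_(x in fcube c) g x) ->
  \int[mu]_(x in \bigcup_(c in P) fcube c) f x <=
  \int[mu]_(x in \bigcup_(c in P) fcube c) g x.
Proof.
move=> mf mg f0 g0 fg; rewrite bigcup_maximal.
rewrite !ge0_integral_bigcup//; last 2 first.
  exact: measurable_funTS.
  exact: measurable_funTS.
apply: lee_nneseries => [*|i _]; first by apply: integral_ge0 => *; exact: f0.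
have [->|/set0P[x /max_cubeP[c [[Pc _] _ _ ->]]]] := eqVneq (max_cube i) set0.
  by rewrite !integral_set0.
exact: fg.
Qed.

End dyadic_covering.

(** * The quantities of the theorem without averages *)

Section unnormalized.
Local Open Scope ereal_scope.
Context {R : realType} {n : nat}.
Local Notation mu := (lebn R n).
Implicit Types (Q E : set (Rn R n)) (v w f g : Rn R n -> R) (k : int).

Lemma lebn_setT_gt0 : 0 < mu [set: Rn R n].
Proof.
have Q0 : 0 < mu (cube 0 (fun=> 0%R)) by rewrite lebn_cube lte_fin cube_vol_gt0.
apply: (lt_le_trans Q0); apply: le_measure; rewrite ?inE//; exact: measurable_cube.
Qed.

Lemma pmass_ge0 t v E : 0 <= pmass t v E.
Proof. by apply: integral_ge0 => x _; rewrite lee_fin powR_ge0. Qed.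

Lemma mean_poweR Q (c a : R) (h : Rn R n -> \bar R) : mu Q = c%:E -> (0 < c)%R ->
  (forall x, 0 <= h x) ->
  mean Q h `^ a = (\int[mu]_(x in Q) h x) `^ a * (c `^ (- a))%:E.
Proof.
move=> Qc c0 h0; rewrite /mean Qc inver gt_eqF// poweRM ?lee_fin ?invr_ge0 ?(ltW c0)//.
  by rewrite poweR_EFin -powR_inv1 ?(ltW c0)// -powRrM mulN1r.
by apply: integral_ge0 => x _.
Qed.

Lemma dual_factorE w (q r : R) Q (c : R) : mu Q = c%:E -> (0 < c)%R ->
  (forall x, 0 <= w x)%R -> (0 < r)%R -> (r <= q)%R ->
  dual_factor w q r Q = dual_norm mu q r w Q * (c `^ (- (r^-1 - q^-1)))%:E.
Proof.
move=> Qc c0 w0 r0; rewrite le_eqVlt /dual_factor /dual_norm => /predU1P[->|rq].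
  by rewrite eqxx subrr oppr0 powRr0 mule1.
rewrite gt_eqF// (mean_poweR _ Qc c0)//; first by rewrite inv_dual_exponent.
by move=> x; exact: poweR_ge0.
Qed.

Lemma lpnorm_mean Q (c r : R) f : mu Q = c%:E -> (0 < c)%R ->
  mean Q (fun x => (f x `^ r)%:E) `^ r^-1 = lpnorm mu r Q f * (c `^ (- r^-1))%:E.
Proof.
move=> Qc c0; rewrite (mean_poweR _ Qc c0)// => x.
by rewrite lee_fin powR_ge0.
Qed.

End unnormalized.

Section terms.
Local Open Scope ereal_scope.
Context {R : realType} {n : nat}.
Local Notation mu := (lebn R n).
Implicit Types (Q E : set (Rn R n)) (v w f g : Rn R n -> R) (k : int).
Variables (alpha p q t s q1 q2 r1 r2 : R) (r : \bar R).
Hypotheses (r1_bounds : (0 < r1 <= q1)%R) (r2_bounds : (0 < r2 <= q2)%R).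
Hypothesis q_eq : (q^-1 = q1^-1 + q2^-1)%R.
Hypothesis s_eq : (s^-1 = p^-1 + rinv r - alpha / n%:R)%R.

(** The exponent of the volume on the right-hand side of the inequality, see
    [morrey_termE]. *)
Definition morrey_exp : R := (p^-1 - q^-1)%R.

(** The exponent of the volume in the weight condition, see [const_termE]. *)
Definition dual_exp : R :=
  (s^-1 - rinv r + (r1^-1 - q1^-1) + (r2^-1 - q2^-1))%R.

(** The expressions whose suprema over cubes are the maximal function, the
    right-hand side of the inequality and the weight constant. *)
Definition max_term f g Q : \bar R :=
  mu Q `^ (alpha / n%:R) * mean Q (fun y => (`|f y| `^ r1)%:E) `^ r1^-1
  * mean Q (fun y => (`|g y| `^ r2)%:E) `^ r2^-1.

Definition morrey_term w1 w2 f g Q : \bar R :=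
  mu Q `^ p^-1 * mean Q (fun x => ((`|f x| * w1 x) `^ q1)%:E) `^ q1^-1
  * mean Q (fun x => ((`|g x| * w2 x) `^ q2)%:E) `^ q2^-1.

Definition const_term v w1 w2 Q Q' : \bar R :=
  (mu Q / mu Q') `^ s^-1 * mu Q' `^ (rinv r)
  * mean Q (fun x => (v x `^ t)%:E) `^ t^-1
  * (dual_factor w1 q1 r1 Q' * dual_factor w2 q2 r2 Q').

(** The mass of [v^t] on [Q], normalized as on the left-hand side of the
    inequality. *)
Definition vmass v Q : \bar R := mu Q `^ (s^-1 - t^-1) * pmass t v Q `^ t^-1.

Let r1_gt0 : (0 < r1)%R. Proof. by case/andP: r1_bounds. Qed.
Let r2_gt0 : (0 < r2)%R. Proof. by case/andP: r2_bounds. Qed.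
Let rq1 : (r1 <= q1)%R. Proof. by case/andP: r1_bounds. Qed.
Let rq2 : (r2 <= q2)%R. Proof. by case/andP: r2_bounds. Qed.

Lemma max_exponent :
  (alpha / n%:R - r1^-1 - r2^-1 = morrey_exp - dual_exp)%R.
Proof. by rewrite /morrey_exp /dual_exp q_eq s_eq; ring. Qed.

Lemma max_termE f g Q (c : R) : mu Q = c%:E -> (0 < c)%R ->
  max_term f g Q = (c `^ (morrey_exp - dual_exp))%:E *
    (lpnorm mu r1 Q (fun x => `|f x|)%R * lpnorm mu r2 Q (fun x => `|g x|)%R).
Proof.
move=> Qc c0; rewrite /max_term Qc (poweR_EFin c).
apply: (etrans (congr2 mule (congr2 mule erefl
  (lpnorm_mean r1 (fun x => `|f x|)%R Qc c0))
  (lpnorm_mean r2 (fun x => `|g x|)%R Qc c0))).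
rewrite -max_exponent !powRD ?(gt_eqF c0) ?implybT//.
by rewrite !EFinM [LHS](AC (1*2*2) (1*3*5*(2*4))).
Qed.

Lemma morrey_termE w1 w2 f g Q (c : R) : mu Q = c%:E -> (0 < c)%R ->
  morrey_term w1 w2 f g Q = (c `^ morrey_exp)%:E *
    (lpnorm mu q1 Q (fun x => `|f x| * w1 x)%R *
     lpnorm mu q2 Q (fun x => `|g x| * w2 x)%R).
Proof.
move=> Qc c0; rewrite /morrey_term Qc (poweR_EFin c).
apply: (etrans (congr2 mule (congr2 mule erefl
  (lpnorm_mean q1 (fun x => `|f x| * w1 x)%R Qc c0))
  (lpnorm_mean q2 (fun x => `|g x| * w2 x)%R Qc c0))).
rewrite /morrey_exp q_eq opprD addrA !powRD ?(gt_eqF c0) ?implybT//.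
by rewrite !EFinM [LHS](AC (1*2*2) (1*3*5*(2*4))).
Qed.

Lemma vmassE v Q (c : R) : mu Q = c%:E ->
  vmass v Q = (c `^ (s^-1 - t^-1))%:E * pmass t v Q `^ t^-1.
Proof. by move=> Qc; rewrite /vmass Qc poweR_EFin. Qed.

Lemma const_termE v w1 w2 Q Q' (c c' : R) : mu Q = c%:E -> (0 < c)%R ->
  mu Q' = c'%:E -> (0 < c')%R ->
  (forall x, 0 <= w1 x)%R -> (forall x, 0 <= w2 x)%R ->
  const_term v w1 w2 Q Q' =
    vmass v Q * (dual_norm mu q1 r1 w1 Q' * dual_norm mu q2 r2 w2 Q')
    * (c' `^ (- dual_exp))%:E.
Proof.
move=> Qc c0 Qc' c0' w10 w20; rewrite /const_term (vmassE _ Qc).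
rewrite (lpnorm_mean t v Qc c0).
rewrite (dual_factorE Qc' c0' w10)// (dual_factorE Qc' c0' w20)//.
rewrite Qc Qc' inver gt_eqF// -EFinM.
have -> : (- dual_exp = - s^-1 + rinv r + - (r1^-1 - q1^-1) + - (r2^-1 - q2^-1))%R.
  by rewrite /dual_exp; ring.
rewrite powRM ?invr_ge0 ?(ltW c0) ?(ltW c0')// -(powR_inv1 (ltW c0')) -powRrM mulN1r.
rewrite ![(c' `^ (_ + _))%R]powRD ?(gt_eqF c0') ?implybT// powRD ?(gt_eqF c0) ?implybT//.
by rewrite !EFinM [LHS](AC (2*1*2*(2*2)) (1*5*4*(6*8)*(2*3*7*9))).
Qed.

Lemma vmass_ge0 v Q : 0 <= vmass v Q.
Proof. by rewrite mule_ge0 ?poweR_ge0. Qed.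

Lemma const_term_ge0 v w1 w2 Q Q' : 0 <= const_term v w1 w2 Q Q'.
Proof.
rewrite !mule_ge0 ?poweR_ge0// /dual_factor; case: ifP => _;
  by rewrite ?Lnorm_ge0 ?poweR_ge0.
Qed.

Lemma weight_const_ge0 v w1 w2 :
  0 <= weight_const t q1 q2 r s r1 r2 v w1 w2.
Proof.
pose Q : set (Rn R n) := cube 0 (fun=> 0%R).
apply: (le_trans (const_term_ge0 v w1 w2 Q Q)).
by apply: ereal_sup_ubound; exists Q, Q; split => //; exact: dyadic_cube.
Qed.

Lemma morrey_term_ge0 w1 w2 f g Q : 0 <= morrey_term w1 w2 f g Q.
Proof. by rewrite !mule_ge0 ?poweR_ge0. Qed.

End terms.

(** * Sufficiency of the weight condition *)

Lemma measurable_normM d (T : measurableType d) (R : realType) (f w : T -> R) :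
  measurable_fun [set: T] f -> measurable_fun [set: T] w ->
  measurable_fun [set: T] (fun x => `|f x| * w x).
Proof. by move=> mf mw; apply: measurable_funM => //; exact: measurableT_comp. Qed.

Section sufficiency.
Local Open Scope ereal_scope.
Context {R : realType} {n : nat}.
Local Notation mu := (lebn R n).
Implicit Types (Q E : set (Rn R n)) (f g : Rn R n -> R) (k : int).
Variables (alpha p q t s q1 q2 r1 r2 : R) (r : \bar R).
Hypotheses (r1_bounds : (0 < r1 <= q1)%R) (r2_bounds : (0 < r2 <= q2)%R).
Hypothesis q_eq : (q^-1 = q1^-1 + q2^-1)%R.
Hypothesis s_eq : (s^-1 = p^-1 + rinv r - alpha / n%:R)%R.
Hypothesis t_eq : (t^-1 = q^-1 + rinv r - alpha / n%:R)%R.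
Hypotheses (t_gt0 : (0 < t)%R) (q_gt0 : (0 < q)%R).
Hypothesis alpha_r : (rinv r <= alpha / n%:R)%R.
Variables v w1 w2 : Rn R n -> R.
Hypotheses (mv : measurable_fun [set: Rn R n] v) (mw1 : measurable_fun [set: Rn R n] w1)
  (mw2 : measurable_fun [set: Rn R n] w2).
Hypotheses (w10 : forall x, (0 <= w1 x)%R) (w20 : forall x, (0 <= w2 x)%R).

Let W := weight_const t q1 q2 r s r1 r2 v w1 w2.
Hypothesis Wfin : W < +oo.

Let r1_gt0 : (0 < r1)%R. Proof. by case/andP: r1_bounds. Qed.
Let r2_gt0 : (0 < r2)%R. Proof. by case/andP: r2_bounds. Qed.
Let rq1 : (r1 <= q1)%R. Proof. by case/andP: r1_bounds. Qed.
Let rq2 : (r2 <= q2)%R. Proof. by case/andP: r2_bounds. Qed.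
Let q1_gt0 : (0 < q1)%R. Proof. exact: lt_le_trans rq1. Qed.
Let q2_gt0 : (0 < q2)%R. Proof. exact: lt_le_trans rq2. Qed.
Let muT0 := @lebn_setT_gt0 R n.

Let qt : (q <= t)%R.
Proof.
rewrite -[q]invrK -[t]invrK lef_pV2 ?posrE ?invr_gt0//.
by rewrite t_eq -addrA gerDl subr_le0.
Qed.

Lemma const_term_le Q Q' : dyadic Q -> dyadic Q' -> Q `<=` Q' ->
  const_term t s q1 q2 r1 r2 r v w1 w2 Q Q' <= W.
Proof. by move=> dQ dQ' QQ'; apply: ereal_sup_ubound; exists Q, Q'; split. Qed.

Let W_ge0 : 0 <= W. Proof. exact: weight_const_ge0. Qed.

(** The estimate behind both cases: a large value of the maximal average on [Q']
    controls the mass of [v] on every smaller cube. *)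
Lemma vmass_le k m k' m' f g (lambda : R) :
  measurable_fun [set: Rn R n] f -> measurable_fun [set: Rn R n] g ->
  (cube k m : set (Rn R n)) `<=` cube k' m' -> (0 < lambda)%R ->
  lambda%:E < max_term alpha r1 r2 f g (cube k' m') ->
  vmass t s v (cube k m) * lambda%:E <=
  W * morrey_term p q1 q2 w1 w2 f g (cube k' m').
Proof.
move=> mf mg QQ' l0 lM; set Q := cube k m; set Q' := cube k' m'.
have Qc := @lebn_cube R n k m; have c0 := @cube_vol_gt0 R n k.
have Qc' := @lebn_cube R n k' m'; have c0' := @cube_vol_gt0 R n k'.
have V0 : 0 <= vmass t s v Q by exact: vmass_ge0.
(* if V(Q) = 0 the dual norms may be infinite *)
have [V_eq0|V_neq0] := eqVneq (vmass t s v Q) 0.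
  by rewrite V_eq0 mul0e mule_ge0// morrey_term_ge0.
have V_gt0 : 0 < vmass t s v Q by rewrite lt0e V_neq0.
have le_W := const_term_le (dyadic_cube k m) (dyadic_cube k' m') QQ'.
have mQ' : measurable Q' by exact: measurable_cube.
have muQ' : 0 < mu Q' by rewrite Qc' lte_fin.
set D1 := dual_norm mu q1 r1 w1 Q'; set D2 := dual_norm mu q2 r2 w2 Q'.
have D1_gt0 : 0 < D1 by exact: dual_norm_gt0.
have D2_gt0 : 0 < D2 by exact: dual_norm_gt0.
rewrite (const_termE _ _ _ r1_bounds r2_bounds _ Qc c0 Qc' c0')// -/D1 -/D2 in le_W.
have pc : 0 < (@cube_vol R n k' `^ - dual_exp s q1 q2 r1 r2 r)%:E :> \bar R.
  by rewrite lte_fin powR_gt0.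
have DDoo : D1 * D2 < +oo.
  rewrite ltNge leye_eq; apply/eqP => DD.
  move: (le_lt_trans le_W Wfin); rewrite DD gt0_muley// gt0_mulye//.
have D1oo : D1 < +oo.
  by rewrite ltNge leye_eq; apply/eqP => D1E; move: DDoo; rewrite D1E gt0_mulye.
have D2oo : D2 < +oo.
  by rewrite ltNge leye_eq; apply/eqP => D2E; move: DDoo; rewrite D2E gt0_muley.
have h1 := weighted_hoelder muT0 r1_gt0 rq1 mQ' mw1 w10 (measurableT_comp (@normr_measurable _ _) mf) (fun=> normr_ge0 _) D1oo.
have h2 := weighted_hoelder muT0 r2_gt0 rq2 mQ' mw2 w20 (measurableT_comp (@normr_measurable _ _) mg) (fun=> normr_ge0 _) D2oo.
apply: (@le_trans _ _ (vmass t s v Q * (D1 * D2) *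
  (@cube_vol R n k' `^ - dual_exp s q1 q2 r1 r2 r)%:E *
  morrey_term p q1 q2 w1 w2 f g Q')); last first.
  by apply: lee_wpmul2r => //; exact: morrey_term_ge0.
apply: (le_trans (lee_wpmul2l V0 (ltW lM))).
rewrite (max_termE _ _ q_eq s_eq _ _ Qc' c0') (morrey_termE _ q_eq _ _ _ _ Qc' c0').
rewrite powRD ?(gt_eqF c0') ?implybT// EFinM.
set cA := (_ `^ morrey_exp _ _)%:E; set cD := (_ `^ - _)%:E.
set N1 := lpnorm mu q1 _ _; set N2 := lpnorm mu q2 _ _.
have -> : vmass t s v Q * (D1 * D2) * cD * (cA * (N1 * N2)) =
    vmass t s v Q * (cA * cD * ((N1 * D1) * (N2 * D2))).
  by rewrite [LHS](AC (1*2*1*(1*2)) (1*((5*4)*((6*2)*(7*3))))).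
by rewrite lee_wpmul2l// lee_wpmul2l ?mule_ge0 ?lee_fin ?powR_ge0// lee_pmul// lpnorm_ge0.
Qed.

Let exponents_eq : (s^-1 - t^-1 = morrey_exp p q)%R.
Proof. by rewrite /morrey_exp s_eq t_eq; ring. Qed.

(** The case of equal cubes, where the volume factors cancel. *)
Lemma cube_mass_le k m f g (lambda : R) :
  measurable_fun [set: Rn R n] f -> measurable_fun [set: Rn R n] g ->
  (0 < lambda)%R -> lambda%:E < max_term alpha r1 r2 f g (cube k m) ->
  (lambda `^ t)%:E * pmass t v (cube k m) <= W `^ t *
    (lpnorm mu q1 (cube k m) (fun x => `|f x| * w1 x)%R *
     lpnorm mu q2 (cube k m) (fun x => `|g x| * w2 x)%R) `^ t.
Proof.
move=> mf mg l0 lM.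
have Qc := @lebn_cube R n k m; have c0 := @cube_vol_gt0 R n k.
have := vmass_le mf mg (@subset_refl _ (cube k m)) l0 lM.
rewrite (vmassE _ _ _ Qc) (morrey_termE _ q_eq _ _ _ _ Qc c0) exponents_eq.
rewrite -muleA [leRHS]muleCA lee_pmul2l ?lte_fin ?powR_gt0// => H.
have V0 : 0 <= pmass t v (cube k m) `^ t^-1 * lambda%:E.
  by rewrite mule_ge0 ?poweR_ge0// lee_fin ltW.
move: (le_poweR (ltW t_gt0) V0 H).
rewrite poweRM ?poweR_ge0 ?lee_fin ?(ltW l0)// poweRVK ?gt_eqF ?pmass_ge0//.
rewrite [X in X <= _]muleC [X in _ <= X]poweRM ?mule_ge0 ?lpnorm_ge0//.
Qed.

(** When no cube containing [Q0] has a large average, the set in question is the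
    union of the subcubes of [Q0] with a large average, and [dyadic_covering]
    compares [lambda^t v^t] with the integrable function [h] given by
    [young_powR]. *)
Lemma weak_type_sufficient :
  weak_type_bound alpha p t s q1 q2 r1 r2 v w1 w2 W.
Proof.
move=> Q0 f g [k0 [m0 Q0E]] mf mg; apply: ge_ereal_sup => _ [lambda l0 <-].
have {}l0 : (0 < lambda)%R := l0.
rewrite {Q0}Q0E -/(cube k0 m0).
set Q0 := cube k0 m0; set S := [set x | _ /\ _]; set sup := ereal_sup _.
have Qc := @lebn_cube R n k0 m0; have c0 := @cube_vol_gt0 R n k0.
have mQ0 : measurable Q0 by exact: measurable_cube.
have sup_ge Q : dyadic Q -> Q0 `<=` Q -> morrey_term p q1 q2 w1 w2 f g Q <= sup.
  by move=> dQ Q0Q; apply: ereal_sup_ubound; exists Q.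
have [[k [m [Q0Q lM]]]|small] := pselect (exists k m,
    Q0 `<=` cube k m /\ lambda%:E < max_term alpha r1 r2 f g (cube k m)).
  have -> : S = Q0.
    apply/seteqP; split => [x []//|x Q0x]; split => //; apply: (lt_le_trans lM).
    apply: ereal_sup_ubound; exists (cube k m) => //; split; last exact: Q0Q.
    exact: dyadic_cube.
  apply: (@le_trans _ _ (W * morrey_term p q1 q2 w1 w2 f g (cube k m))); last first.
    by rewrite lee_wpmul2l// sup_ge//; exact: dyadic_cube.
  by rewrite muleAC; exact: vmass_le.
pose P : set (int * {ffun 'I_n -> int}) := [set c : int * {ffun 'I_n -> int} | [/\ (k0 <= c.1)%R,
  cube c.1 c.2 `<=` Q0 & lambda%:E < max_term alpha r1 r2 f g (cube c.1 c.2)]].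
have SE : S = \bigcup_(c in P) cube c.1 c.2.
  apply/seteqP; split => [x [Q0x]|x [c [kc cQ0 lM] cx]]; last first.
    split; first exact: cQ0.
    apply: (lt_le_trans lM); apply: ereal_sup_ubound; exists (cube c.1 c.2) => //.
    by split => //; exact: dyadic_cube.
  move=> /ereal_sup_gt[_ [Q [[k [m ->]] Qx] <-] lM].
  rewrite -/(cube k m) -/(max_term alpha r1 r2 f g (cube k m)) in Qx lM.
  have [kk0|/ltW k0k] := leP k k0.
    by exfalso; apply: small; exists k, m; split => //; exact: cube_nested kk0 Q0x Qx.
  have cE : cube k (finfun m) = cube k m :> set (Rn R n).
    by congr cube; apply/funext => i; rewrite ffunE.
  exists (k, finfun m); rewrite /P /= cE//.
  by split => //; exact: cube_nested k0k Qx Q0x.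
have P_level c : P c -> (k0 <= c.1)%R by case.
have mS : measurable S by rewrite SE; exact: measurable_bigcup_cube P_level.
have SQ0 : S `<=` Q0 by move=> x [].
pose F x := (`|f x| * w1 x)%R; pose G x := (`|g x| * w2 x)%R.
have F0 x : (0 <= F x)%R by rewrite mulr_ge0.
have G0 x : (0 <= G x)%R by rewrite mulr_ge0.
have mF : measurable_fun [set: Rn R n] F.
  exact: (measurable_normM mf mw1).
have mG : measurable_fun [set: Rn R n] G.
  exact: (measurable_normM mg mw2).
pose A := lpnorm mu q1 Q0 F; pose B := lpnorm mu q2 Q0 G.
have A0 : 0 <= A by exact: lpnorm_ge0.
have B0 : 0 <= B by exact: lpnorm_ge0.
have lt0 : (0 < lambda `^ t)%R by rewrite powR_gt0.
have lt_e0 : 0 <= (lambda `^ t)%:E by rewrite lee_fin ltW.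
have mvt := @measurable_powRE _ _ _ v t mv.
have v_t0 x : 0 <= (v x `^ t)%:E by rewrite lee_fin powR_ge0.
have mlvt : measurable_fun [set: Rn R n]
    (fun x => (lambda `^ t)%:E * (v x `^ t)%:E) by exact: measurable_funeM.
have intv E : measurable E ->
    \int[mu]_(x in E) ((lambda `^ t)%:E * (v x `^ t)%:E) =
    (lambda `^ t)%:E * pmass t v E.
  by move=> mE; exact: (ge0_integralZl mu mE (measurable_funTS mvt)
    (fun x _ => v_t0 x) lt_e0).
have lvt0 x : 0 <= (lambda `^ t)%:E * (v x `^ t)%:E by exact: mule_ge0.
suff main : (lambda `^ t)%:E * pmass t v S <= W `^ t * (A * B) `^ t.
  apply: (@le_trans _ _ (W * morrey_term p q1 q2 w1 w2 f g Q0)); last first.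
    by rewrite lee_wpmul2l// sup_ge//; exact: dyadic_cube.
  rewrite (morrey_termE _ q_eq _ _ _ _ Qc c0) Qc -exponents_eq poweR_EFin.
  rewrite -muleA [leRHS]muleCA lee_wpmul2l ?lee_fin ?powR_ge0//.
  apply: (le_poweR_inj t_gt0); rewrite ?mule_ge0 ?poweR_ge0 ?lee_fin ?(ltW l0)//.
  rewrite !(poweRM _ (y := _ * _)) ?mule_ge0// [X in X <= _]poweRM ?poweR_ge0 ?lee_fin ?(ltW l0)//.
  by rewrite poweRVK ?gt_eqF ?pmass_ge0.
have bad_le c : P c -> (lambda `^ t)%:E * pmass t v (cube c.1 c.2) <= W `^ t *
    (lpnorm mu q1 (cube c.1 c.2) F * lpnorm mu q2 (cube c.1 c.2) G) `^ t.
  by move=> [_ _ lM]; exact: cube_mass_le.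
have sub_le c : P c -> lpnorm mu q1 (cube c.1 c.2) F <= A /\
    lpnorm mu q2 (cube c.1 c.2) G <= B.
  by move=> [_ cQ0 _]; split; apply: lpnorm_subset => //; exact: measurable_cube.
clearbody F G.
have [Moo|Mfin] := eqVneq (W `^ t * (A * B) `^ t) +oo; first by rewrite Moo leey.
(* one of W, A, B is zero, and then v^t has no mass on the cubes of the family *)
have [M0|M_neq0] := eqVneq (W `^ t * (A * B) `^ t) 0.
  rewrite M0 -(intv _ mS) SE.
  apply: (le_trans (dyadic_covering P_level (g := cst 0) mlvt _ lvt0 _ _)) => //.
    move=> c Pc; rewrite integral_cst// ?mul0e; last exact: measurable_cube.
    rewrite intv; last exact: measurable_cube.
    apply: (le_trans (bad_le _ Pc)); rewrite -M0.
    have [leA leB] := sub_le _ Pc.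
    rewrite lee_wpmul2l ?poweR_ge0// le_poweR ?(ltW t_gt0) ?mule_ge0 ?lpnorm_ge0//.
    by apply: lee_pmul; rewrite ?lpnorm_ge0.
  by rewrite integral0.
have WAB_gt0 : 0 < W `^ t * (A * B) `^ t by rewrite lt0e M_neq0 mule_ge0 ?poweR_ge0.
move: (WAB_gt0); rewrite mule_ge0_gt0 ?poweR_ge0// => /andP[Wt_gt0 ABt_gt0].
have W_gt0 : 0 < W by exact: gt0_poweR t_gt0 _ Wt_gt0.
have AB_gt0 : 0 < A * B by apply: gt0_poweR t_gt0 _ ABt_gt0; rewrite mule_ge0.
move: (AB_gt0); rewrite mule_ge0_gt0// => /andP[A_gt0 B_gt0].
have AB_fin : A * B < +oo.
  rewrite ltNge leye_eq; apply/eqP => ABoo; move/eqP: Mfin; apply.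
  by rewrite ABoo poweRyr ?gt_eqF// gt0_muley.
have A_fin : A \is a fin_num.
  rewrite ge0_fin_numE// ltNge leye_eq; apply/eqP => AE; move: AB_fin.
  by rewrite AE gt0_mulye.
have B_fin : B \is a fin_num.
  rewrite ge0_fin_numE// ltNge leye_eq; apply/eqP => BE; move: AB_fin.
  by rewrite BE gt0_muley.
have W_fin : W \is a fin_num by rewrite ge0_fin_numE.
pose a E := \int[mu]_(x in E) (F x `^ q1)%:E.
pose b E := \int[mu]_(x in E) (G x `^ q2)%:E.
have aA : a Q0 = A `^ q1 by rewrite lpnorm_poweR.
have bB : b Q0 = B `^ q2 by rewrite lpnorm_poweR.
have a0E : (fine (a Q0))%:E = a Q0 by rewrite fineK// aA fin_num_poweR.
have b0E : (fine (b Q0))%:E = b Q0 by rewrite fineK// bB fin_num_poweR.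
set a0 := fine (a Q0) in a0E; set b0 := fine (b Q0) in b0E.
have a0_gt0 : (0 < a0)%R by rewrite -lte_fin a0E aA poweR_gt0.
have b0_gt0 : (0 < b0)%R by rewrite -lte_fin b0E bB poweR_gt0.
clearbody a0 b0.
pose Wr := (fine W `^ t)%R.
have WE : W `^ t = Wr%:E by rewrite -(fineK W_fin) poweR_EFin.
pose K := ((a0 `^ q1^-1 * b0 `^ q2^-1) `^ t)%R.
have KE : (A * B) `^ t = K%:E.
  by rewrite /A /B /lpnorm -/(a Q0) -/(b Q0) -a0E -b0E.
have Wr0 : (0 <= Wr)%R by exact: powR_ge0.
have K0 : (0 <= K)%R by exact: powR_ge0.
clearbody Wr.
have [M1 M1E] : {x : R | x = Wr * (K * (q / q1 / a0))}%R by exists (Wr * (K * (q / q1 / a0)))%R.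
have [M2 M2E] : {x : R | x = Wr * (K * (q / q2 / b0))}%R by exists (Wr * (K * (q / q2 / b0)))%R.
have M10 : (0 <= M1)%R by rewrite M1E !mulr_ge0 ?invr_ge0 ?(ltW q_gt0) ?(ltW q1_gt0) ?(ltW a0_gt0).
have M20 : (0 <= M2)%R by rewrite M2E !mulr_ge0 ?invr_ge0 ?(ltW q_gt0) ?(ltW q2_gt0) ?(ltW b0_gt0).
pose h x := M1%:E * (F x `^ q1)%:E + M2%:E * (G x `^ q2)%:E.
have mFq := @measurable_powRE _ _ _ F q1 mF.
have mGq := @measurable_powRE _ _ _ G q2 mG.
have mFh : measurable_fun [set: Rn R n] (fun x => M1%:E * (F x `^ q1)%:E).
  exact: measurable_funeM.
have mGh : measurable_fun [set: Rn R n] (fun x => M2%:E * (G x `^ q2)%:E).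
  exact: measurable_funeM.
have mh : measurable_fun [set: Rn R n] h by exact: emeasurable_funD.
have Fq0 x : 0 <= (F x `^ q1)%:E by rewrite lee_fin powR_ge0.
have Gq0 x : 0 <= (G x `^ q2)%:E by rewrite lee_fin powR_ge0.
have M1e0 : 0 <= M1%:E by rewrite lee_fin.
have M2e0 : 0 <= M2%:E by rewrite lee_fin.
have Fh0 x : 0 <= M1%:E * (F x `^ q1)%:E by exact: mule_ge0.
have Gh0 x : 0 <= M2%:E * (G x `^ q2)%:E by exact: mule_ge0.
have h0 x : 0 <= h x by exact: (adde_ge0 (Fh0 x) (Gh0 x)).
have inth E : measurable E -> \int[mu]_(x in E) h x = M1%:E * a E + M2%:E * b E.
  move=> mE; rewrite (ge0_integralD mu mE (fun x _ => Fh0 x) (measurable_funTS mFh)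
    (fun x _ => Gh0 x) (measurable_funTS mGh)).
  by rewrite (ge0_integralZl mu mE (measurable_funTS mFq) (fun x _ => Fq0 x) M1e0)
    (ge0_integralZl mu mE (measurable_funTS mGq) (fun x _ => Gq0 x) M2e0).
have qsum : (q / q1 + q / q2 = 1)%R by rewrite -mulrDr -q_eq mulfV ?gt_eqF.
rewrite -(intv _ mS).
apply: (@le_trans _ _ (\int[mu]_(x in Q0) h x)).
  apply: (@le_trans _ _ (\int[mu]_(x in S) h x)); last first.
    exact: (ge0_subset_integral mu mS mQ0 (measurable_funTS mh) (fun x _ => h0 x) SQ0).
  rewrite SE; apply: (dyadic_covering P_level mlvt mh lvt0 h0) => c Pc.
  have mc : measurable (cube c.1 c.2 : set (Rn R n)) by exact: measurable_cube.
  have cQ0 : cube c.1 c.2 `<=` Q0 by case: Pc.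
  rewrite (intv _ mc) (inth _ mc); apply: (le_trans (bad_le _ Pc)).
  rewrite /lpnorm -/(a _) -/(b _).
  have ac0 : 0 <= a (cube c.1 c.2) by exact: int_powR_ge0.
  have bc0 : 0 <= b (cube c.1 c.2) by exact: int_powR_ge0.
  have acA : a (cube c.1 c.2) <= a0%:E.
    rewrite a0E.
    exact: (ge0_subset_integral mu mc mQ0 (measurable_funTS mFq) (fun x _ => Fq0 x) cQ0).
  have bcB : b (cube c.1 c.2) <= b0%:E.
    rewrite b0E.
    exact: (ge0_subset_integral mu mc mQ0 (measurable_funTS mGq) (fun x _ => Gq0 x) cQ0).
  have /fineK acE : a (cube c.1 c.2) \is a fin_num.
    by rewrite ge0_fin_numE// (le_lt_trans acA) ?ltry.
  have /fineK bcE : b (cube c.1 c.2) \is a fin_num.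
    by rewrite ge0_fin_numE// (le_lt_trans bcB) ?ltry.
  move: acE bcE ac0 bc0 acA bcB.
  move: (fine (a (cube c.1 c.2))) (fine (b (cube c.1 c.2))) => x y <- <-; rewrite !lee_fin => x0 y0 xa yb.
  rewrite WE -!EFinM -EFinD lee_fin.
  have x0a : (0 <= x <= a0)%R by apply/andP.
  have y0b : (0 <= y <= b0)%R by apply/andP.
  have Y := young_powR q1_gt0 q2_gt0 q_eq q_gt0 qt x0a y0b a0_gt0 b0_gt0.
  apply: (le_trans (ler_wpM2l Wr0 Y)); rewrite -/K.
  suff -> : (Wr * (K * (q / q1 * (x / a0) + q / q2 * (y / b0))) = M1 * x + M2 * y)%R by [].
  by rewrite M1E M2E; field; rewrite !gt_eqF.
rewrite (inth _ mQ0) -a0E -b0E WE KE -!EFinM -EFinD lee_fin.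
suff -> : (M1 * a0 + M2 * b0 = Wr * K * (q / q1 + q / q2))%R by rewrite qsum mulr1.
by rewrite M1E M2E; field; rewrite !gt_eqF.
Qed.

End sufficiency.

(** * Necessity of the weight condition *)

Section necessity.
Local Open Scope ereal_scope.
Context {R : realType} {n : nat}.
Local Notation mu := (lebn R n).
Implicit Types (Q E : set (Rn R n)) (f g : Rn R n -> R) (k l : int).
Variables (alpha p q t s q1 q2 r1 r2 : R) (r : \bar R).
Hypotheses (r1_bounds : (0 < r1 <= q1)%R) (r2_bounds : (0 < r2 <= q2)%R).
Hypothesis q_eq : (q^-1 = q1^-1 + q2^-1)%R.
Hypothesis s_eq : (s^-1 = p^-1 + rinv r - alpha / n%:R)%R.
Hypothesis pq_bounds : (0 < q <= p)%R.
Hypothesis rs : (rinv r < s^-1)%R.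
Hypothesis n_gt0 : (0 < n)%N.
Variables v w1 w2 : Rn R n -> R.
Hypotheses (mw1 : measurable_fun [set: Rn R n] w1)
  (mw2 : measurable_fun [set: Rn R n] w2).
Hypotheses (w10 : forall x, (0 <= w1 x)%R) (w20 : forall x, (0 <= w2 x)%R).
Variable K : R.
Hypothesis K0 : (0 <= K)%R.
Hypothesis weakK : weak_type_bound alpha p t s q1 q2 r1 r2 v w1 w2 K%:E.

Let r1_gt0 : (0 < r1)%R. Proof. by case/andP: r1_bounds. Qed.
Let r2_gt0 : (0 < r2)%R. Proof. by case/andP: r2_bounds. Qed.
Let rq1 : (r1 <= q1)%R. Proof. by case/andP: r1_bounds. Qed.
Let rq2 : (r2 <= q2)%R. Proof. by case/andP: r2_bounds. Qed.
Let q1_gt0 : (0 < q1)%R. Proof. exact: lt_le_trans rq1. Qed.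
Let q2_gt0 : (0 < q2)%R. Proof. exact: lt_le_trans rq2. Qed.
Let muT0 := @lebn_setT_gt0 R n.

Let kappa : R := morrey_exp p q.
Let theta : R := dual_exp s q1 q2 r1 r2 r.

Let kappa_le0 : (kappa <= 0)%R.
Proof.
case/andP: pq_bounds => q0 qp.
by rewrite /kappa /morrey_exp subr_le0 lef_pV2 ?posrE// (lt_le_trans q0).
Qed.

Let theta_gt0 : (0 < theta)%R.
Proof.
have h1 : (0 <= r1^-1 - q1^-1)%R by rewrite subr_ge0 lef_pV2.
have h2 : (0 <= r2^-1 - q2^-1)%R by rewrite subr_ge0 lef_pV2.
by move: rs h1 h2; rewrite /theta /dual_exp; lra.
Qed.

Let V Q := vmass t s v Q.
Let D1 := dual_norm mu q1 r1 w1.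
Let D2 := dual_norm mu q2 r2 w2.
Let V_ge0 Q : 0 <= V Q. Proof. exact: vmass_ge0. Qed.
Let D1_ge0 E : 0 <= D1 E. Proof. exact: dual_norm_ge0. Qed.
Let D2_ge0 E : 0 <= D2 E. Proof. exact: dual_norm_ge0. Qed.

(** Testing the inequality on near-extremizers supported in [E1] and [E2].  The
    condition on [E1] and [E2] makes the supremum on the right-hand side be
    attained at the cube of level [l]. *)
Lemma testing k l (x0 : Rn R n) E1 E2 (N1 N2 : R) : (l <= k)%R ->
  measurable E1 -> measurable E2 ->
  E1 `<=` cube_at l x0 -> E2 `<=` cube_at l x0 ->
  (forall l', (l < l' <= k)%R -> [disjoint E1 & cube_at l' x0] \/
     [disjoint E2 & cube_at l' x0]) ->
  (0 < N1)%R -> (0 < N2)%R -> N1%:E < D1 E1 -> N2%:E < D2 E2 ->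
  V (cube_at k x0) * (N1 * N2)%:E <= (K * @cube_vol R n l `^ theta)%:E.
Proof.
move=> lk mE1 mE2 E1l E2l E12 N10 N20 ND1 ND2.
set Q0 := cube_at k x0; set Q := cube_at l x0; set c := @cube_vol R n l.
have c0 : (0 < c)%R by exact: cube_vol_gt0.
have Qc : mu Q = c%:E by exact: lebn_cube.
have mQ : measurable Q by exact: measurable_cube.
have E1oo : mu E1 < +oo.
  by apply: (@le_lt_trans _ _ (mu Q)); [apply: le_measure; rewrite ?inE|rewrite Qc ltry].
have E2oo : mu E2 < +oo.
  by apply: (@le_lt_trans _ _ (mu Q)); [apply: le_measure; rewrite ?inE|rewrite Qc ltry].
have [f [[mf f0 fE] [f1 fN]]] := weighted_hoelder_sharp muT0 r1_gt0 rq1 mE1 E1oo mw1 w10 N10 ND1.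
have [g [[mg g0 gE] [g1 gN]]] := weighted_hoelder_sharp muT0 r2_gt0 rq2 mE2 E2oo mw2 w20 N20 ND2.
have fabs : (fun x => `|f x|)%R = f by apply/funext => x; rewrite ger0_norm.
have gabs : (fun x => `|g x|)%R = g by apply/funext => x; rewrite ger0_norm.
have fwabs : (fun x => `|f x| * w1 x)%R = (fun x => f x * w1 x)%R.
  by apply/funext => x; rewrite ger0_norm.
have gwabs : (fun x => `|g x| * w2 x)%R = (fun x => g x * w2 x)%R.
  by apply/funext => x; rewrite ger0_norm.
have mfw : measurable_fun [set: Rn R n] (fun x => f x * w1 x)%R.
  exact: measurable_funM.
have mgw : measurable_fun [set: Rn R n] (fun x => g x * w2 x)%R.
  exact: measurable_funM.
have fwE x : ~ E1 x -> (f x * w1 x = 0)%R by move=> /fE ->; rewrite mul0r.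
have gwE x : ~ E2 x -> (g x * w2 x = 0)%R by move=> /gE ->; rewrite mul0r.
have Q0Q : Q0 `<=` Q by exact: cube_at_sub.
have lM : (c `^ (kappa - theta))%:E < max_term alpha r1 r2 f g Q.
  rewrite (max_termE _ _ q_eq s_eq _ _ Qc c0) fabs gabs -/kappa -/theta.
  rewrite -[ltLHS]mule1 lte_pmul2l ?lte_fin ?powR_gt0//.
  have F1 : 1 < lpnorm mu r1 Q f by apply: (lt_le_trans f1); exact: lpnorm_subset.
  have G1 : 1 < lpnorm mu r2 Q g by apply: (lt_le_trans g1); exact: lpnorm_subset.
  by rewrite -[ltLHS]mule1; apply: lte_pmul.
have := weakK (dyadic_cube k _ : dyadic Q0) mf mg.
set sup := ereal_sup [set mu _ `^ p^-1 * _ * _ | _ in _] => weak.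
have sup_le : sup <= (c `^ kappa * (N1^-1 * N2^-1))%:E.
  apply: ge_ereal_sup => _ [Q'' [[j [m ->]] Q0Q''] <-].
  rewrite -/(cube j m) -/(morrey_term p q1 q2 w1 w2 f g (cube j m)) in Q0Q'' *.
  have jx0 : cube j m x0 by apply: Q0Q''; exact: cube_at_mem.
  (* a cube containing Q0 is the cube at x0 of some level at most k *)
  have [l'' l''k ->] : exists2 l'', (l'' <= k)%R & cube j m = cube_at l'' x0 :> set (Rn R n).
    have [jk|kj] := leP j k; first by exists j => //; exact: cube_atE.
    exists k => //; apply/seteqP; split => //; rewrite (cube_atE jx0).
    exact: cube_at_sub (ltW kj).
  have Qc'' : mu (cube_at l'' x0) = (@cube_vol R n l'')%:E by exact: lebn_cube.
  have c0'' := @cube_vol_gt0 R n l''.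
  have mQ'' : measurable (cube_at l'' x0) by exact: measurable_cube.
  rewrite (morrey_termE _ q_eq _ _ _ _ Qc'' c0'') fwabs gwabs.
  have rhs0 : 0 <= (c `^ kappa * (N1^-1 * N2^-1))%:E.
    by rewrite lee_fin !mulr_ge0 ?powR_ge0// invr_ge0 ltW.
  have [l''l|ll''] := leP l'' l.
    rewrite EFinM EFinM; apply: lee_pmul; rewrite ?mule_ge0 ?lpnorm_ge0 ?lee_fin ?powR_ge0//.
      rewrite -/kappa -[kappa]opprK !(powRN _ (- kappa)) lef_pV2 ?posrE ?powR_gt0//.
      rewrite ge0_ler_powR ?oppr_ge0 ?nnegrE ?(ltW c0) ?(ltW c0'')//.
      exact: cube_vol_anti.
    apply: lee_pmul; rewrite ?lpnorm_ge0//.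
      exact: (le_trans (lpnorm_supp mu q1_gt0 mQ'' mE1 mfw fwE) fN).
    exact: (le_trans (lpnorm_supp mu q2_gt0 mQ'' mE2 mgw gwE) gN).
  have ll''k : (l < l'' <= k)%R by rewrite ll''.
  have [d1|d2] := E12 l'' ll''k.
    rewrite (@lpnorm_eq0 _ _ _ mu q1 _ (fun x => f x * w1 x)%R) ?mul0e ?mule0// => x Qx.
    rewrite fE ?mul0r// => E1x; move/disj_setPS: d1; apply; exact: (conj E1x Qx).
  rewrite (@lpnorm_eq0 _ _ _ mu q2 _ (fun x => g x * w2 x)%R) ?mule0// => x Qx.
  rewrite gE ?mul0r// => E2x; move/disj_setPS: d2; apply; exact: (conj E2x Qx).
set lambda := (c `^ (kappa - theta))%R in lM.
have lambda0 : (0 < lambda)%R by rewrite powR_gt0.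
have VK : V Q0 * lambda%:E <= K%:E * (c `^ kappa * (N1^-1 * N2^-1))%:E.
  apply: le_trans (lee_wpmul2l _ sup_le); last by rewrite lee_fin.
  apply: le_trans weak; apply: ereal_sup_ubound; exists lambda => //.
  rewrite /V /vmass [RHS]muleAC; congr (_ * _ * pmass _ _ _ `^ _).
  apply/seteqP; split => [x []//|x Q0x]; split => //.
  apply: (lt_le_trans lM); apply: ereal_sup_ubound; exists Q => //.
  by split; [exact: dyadic_cube|exact: Q0Q].
have N120 : (0 <= lambda^-1 * (N1 * N2))%R.
  by rewrite !mulr_ge0 ?invr_ge0 ?(ltW lambda0) ?(ltW N10) ?(ltW N20).
have := lee_wpmul2r (x := (lambda^-1 * (N1 * N2))%:E) _ VK.
rewrite lee_fin => /(_ N120); rewrite -muleA -!EFinM mulrA mulfV ?gt_eqF// mul1r.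
move=> /le_trans; apply; rewrite lee_fin.
suff -> : (K * (c `^ kappa * (N1^-1 * N2^-1)) * (lambda^-1 * (N1 * N2)) =
    K * c `^ theta)%R by [].
have -> : (c `^ theta = c `^ kappa * lambda^-1)%R.
  by rewrite /lambda -powRN -powRD ?(gt_eqF c0) ?implybT//; congr powR; ring.
by field; rewrite !gt_eqF.
Qed.

(** [testing] with the near-extremizers replaced by the dual norms themselves. *)
Lemma testing_dual_norm k l (x0 : Rn R n) E1 E2 : (l <= k)%R ->
  measurable E1 -> measurable E2 ->
  E1 `<=` cube_at l x0 -> E2 `<=` cube_at l x0 ->
  (forall l', (l < l' <= k)%R -> [disjoint E1 & cube_at l' x0] \/
     [disjoint E2 & cube_at l' x0]) ->
  V (cube_at k x0) * (D1 E1 * D2 E2) <= (K * @cube_vol R n l `^ theta)%:E.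
Proof.
move=> lk mE1 mE2 E1l E2l E12; rewrite muleA.
have b0 : 0 <= (K * @cube_vol R n l `^ theta)%:E by rewrite lee_fin mulr_ge0 ?powR_ge0.
apply: (mule_le_approx (mule_ge0 (V_ge0 _) (D1_ge0 _)) b0 (D2_ge0 _)) => N2 N20 ND2.
have N2e0 : 0 <= N2%:E by rewrite lee_fin ltW.
rewrite muleAC.
apply: (mule_le_approx (mule_ge0 (V_ge0 _) N2e0) b0 (D1_ge0 _)) => N1 N10 ND1.
by rewrite muleAC -muleA -EFinM; exact: (testing lk mE1 mE2 E1l E2l E12).
Qed.

(** The growth of a dual norm allowed at each step to the parent cube: its square
    is the growth of [|Q|^theta]. *)
Let growth : R := ((2 ^+ n) `^ (theta / 2))%R.

Let growth_gt1 : (1 < growth)%R.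
Proof.
have n1 : (1 < 2 ^+ n :> R)%R by rewrite exprn_egt1 ?ltr1n// -lt0n.
have h : (1 `^ (theta / 2) = 1 :> R)%R by rewrite powR1.
rewrite /growth -[ltLHS]h; apply: gt0_ltr_powR; rewrite ?nnegrE ?divr_gt0//.
Qed.

Let growth2 : (growth * growth = (2 ^+ n) `^ theta)%R.
Proof.
by rewrite /growth -powRD -splitr ?(gt_eqF theta_gt0).
Qed.

Let C1 := ((1 + (growth `^ r1 - 1)^-1) `^ r1^-1)%R.
Let C2 := ((1 + (growth `^ r2 - 1)^-1) `^ r2^-1)%R.
Let M : R := (K * (1 + C1 + C2))%R.

(** Induction over the dyadic ancestors of a cube.  At each step either both dual
    norms grow so little that the gain [2 ^ (n * theta)] of the volume factor
    absorbs it, or one of them is carried by the new part of the cube, where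
    [testing] applies. *)
Lemma ancestors_le k (x0 : Rn R n) (j : nat) :
  let Q := cube_at (k - j%:Z) x0 in
  V (cube_at k x0) * (D1 Q * D2 Q) <= (M * @cube_vol R n (k - j%:Z) `^ theta)%:E.
Proof.
have C10 : (0 <= C1)%R by exact: powR_ge0.
have C20 : (0 <= C2)%R by exact: powR_ge0.
have C1e0 : 0 <= C1%:E by rewrite lee_fin; exact: C10.
have C2e0 : 0 <= C2%:E by rewrite lee_fin; exact: C20.
have mcube l : measurable (cube_at l x0 : set (Rn R n)) by exact: measurable_cube.
have cube_oo l : mu (cube_at l x0) < +oo by rewrite lebn_cube ltry.
have vt0 l : (0 <= @cube_vol R n l `^ theta)%R by exact: powR_ge0.
elim: j => [|j IHj] /=.
  rewrite subr0.
  have jj l' : (k < l' <= k)%R -> [disjoint cube_at k x0 & cube_at l' x0] \/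
      [disjoint cube_at k x0 & cube_at l' x0].
    by case/andP => kl l'k; move: (lt_le_trans kl l'k); rewrite ltxx.
  apply: (le_trans (testing_dual_norm (lexx k) (mcube k) (mcube k) (@subset_refl _ _)
    (@subset_refl _ _) jj)).
  by rewrite lee_fin ler_wpM2r// ler_peMr//; lra.
set l := (k - j.+1%:Z)%R.
have lE : (l + 1 = k - j%:Z)%R by rewrite /l -addn1 PoszD; ring.
have lk : (l <= k)%R by rewrite /l gerBl lez_nat.
rewrite -lE in IHj.
set P := cube_at (l + 1) x0 in IHj *; set Q := cube_at l x0; set F := Q `\` P.
have PQ : P `<=` Q by apply: cube_at_sub; rewrite lerDl.
have mP : measurable P by exact: mcube.
have mQ : measurable Q by exact: mcube.
have mF : measurable F by exact: measurableD.
have FQ : F `<=` Q by exact: subDsetl.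
have Foo : mu F < +oo.
  exact: (le_lt_trans (le_measure mu (mem_set mF) (mem_set mQ) FQ) (cube_oo l)).
have PF : [disjoint P & F] by apply/disj_setPS => x [Px [_ /(_ Px)]].
have QE : P `|` F = Q by rewrite /F setDUK.
have dF l' : (l < l' <= k)%R -> [disjoint F & cube_at l' x0].
  case/andP => ll' _; apply/disj_setPS => x [[_ Px] xl']; apply: Px.
  by apply: cube_at_sub xl'; rewrite lezD1.
have [le1|le1] := dual_norm_dichotomy muT0 r1_gt0 rq1 mP (cube_oo _) mF Foo PF mw1 w10 growth_gt1;
  last first.
  rewrite QE -/(D1 _) -/C1 in le1.
  have T := testing_dual_norm lk mF mQ FQ (@subset_refl _ Q) (fun l' h => or_introl (dF l' h)).
  apply: (@le_trans _ _ (C1%:E * (V (cube_at k x0) * (D1 F * D2 Q)))).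
    rewrite [leRHS]muleCA lee_wpmul2l// muleA lee_wpmul2r//.
  apply: (le_trans (lee_wpmul2l C1e0 T)); rewrite -EFinM lee_fin mulrA ler_wpM2r//.
  by rewrite mulrC ler_wpM2l//; lra.
have [le2|le2] := dual_norm_dichotomy muT0 r2_gt0 rq2 mP (cube_oo _) mF Foo PF mw2 w20 growth_gt1;
  last first.
  rewrite QE -/(D2 _) -/C2 in le2.
  have T := testing_dual_norm lk mQ mF (@subset_refl _ Q) FQ (fun l' h => or_intror (dF l' h)).
  apply: (@le_trans _ _ (C2%:E * (V (cube_at k x0) * (D1 Q * D2 F)))).
    rewrite [leRHS]muleCA lee_wpmul2l// [leRHS]muleCA lee_wpmul2l//.
  apply: (le_trans (lee_wpmul2l C2e0 T)); rewrite -EFinM lee_fin mulrA ler_wpM2r//.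
  by rewrite mulrC ler_wpM2l//; lra.
rewrite QE -/(D1 _) in le1; rewrite QE -/(D2 _) in le2.
have g0 : (0 <= growth)%R by exact: powR_ge0.
apply: (@le_trans _ _ ((growth * growth)%:E * (V (cube_at k x0) * (D1 P * D2 P)))).
  rewrite [leRHS]muleCA lee_wpmul2l// EFinM muleACA.
  by apply: lee_pmul.
apply: (le_trans (lee_wpmul2l _ IHj)); first by rewrite lee_fin mulr_ge0.
rewrite -EFinM lee_fin growth2 mulrCA.
have -> : @cube_vol R n l = (2 ^+ n * @cube_vol R n (l + 1))%R.
  by rewrite -cube_vol_pred addrK.
by rewrite (powRM _ (exprn_ge0 n (ler0n R 2)) (ltW (@cube_vol_gt0 R n (l + 1)))) lexx.
Qed.

Lemma weight_const_finite : weight_const t q1 q2 r s r1 r2 v w1 w2 < +oo.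
Proof.
apply: (@le_lt_trans _ _ M%:E); last exact: ltry.
apply: ge_ereal_sup => _ [Q [Q' [[k [m QE]] [k' [m' Q'E]] QQ' ->]]].
rewrite -/(const_term t s q1 q2 r1 r2 r v w1 w2 Q Q').
rewrite -/(cube k m) in QE; rewrite -/(cube k' m') in Q'E.
have [x0 Qx0] := @cube_nonempty R n k m.
rewrite (cube_atE Qx0) in QE.
have Q'x0 : cube k' m' x0 by rewrite -Q'E; apply: QQ'; rewrite QE; exact: cube_at_mem.
rewrite (cube_atE Q'x0) in Q'E.
have [j Q'j] : exists j : nat, Q' = cube_at (k - j%:Z) x0.
  have [k'k|/ltW kk'] := leP k' k.
    by exists `|k - k'|%N; rewrite Q'E gez0_abs ?subr_ge0 ?subKr.
  (* a cube Q' of larger level than its subset Q is equal to Q *)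
  exists 0%N; rewrite subr0; apply/seteqP; split; last by rewrite -QE.
  by rewrite Q'E; exact: cube_at_sub.
rewrite {}QE {}Q'j.
have Qc := @lebn_cube R n k (fun i => Num.floor (2 ^ k * (tnth x0 i : R)))%R.
have Qc' := @lebn_cube R n (k - j%:Z)%R (fun i => Num.floor (2 ^ (k - j%:Z) * (tnth x0 i : R)))%R.
have c0 := @cube_vol_gt0 R n k; have c0' := @cube_vol_gt0 R n (k - j%:Z)%R.
rewrite (const_termE _ _ _ r1_bounds r2_bounds _ Qc c0 Qc' c0')//.
apply: (le_trans (lee_wpmul2r _ (ancestors_le k x0 j))); first by rewrite lee_fin powR_ge0.
by rewrite -EFinM lee_fin -mulrA -powRD ?(gt_eqF c0') ?implybT// subrr powRr0 mulr1.
Qed.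

End necessity.

(** * The two-weight characterization *)

Theorem theorem2p7 (R : realType) (n : nat)
    (alpha p q t s q1 q2 r1 r2 : R) (r : \bar R)
    (n_gt0 : (0 < n)%N)
    (alpha_bounds : 0 <= alpha < n%:R)
    (pq_bounds : 0 < q <= p)
    (ts_bounds : 0 < t <= s)
    (s_lt_r : (s%:E < r)%E)
    (r1_bounds : 0 < r1 <= q1)
    (r2_bounds : 0 < r2 <= q2)
    (q_eq : q^-1 = q1^-1 + q2^-1)
    (alpha_r : rinv r <= alpha / n%:R)
    (s_eq : s^-1 = p^-1 + rinv r - alpha / n%:R)
    (t_eq : t^-1 = q^-1 + rinv r - alpha / n%:R) :
  exists C : R, 0 < C /\
    forall v w1 w2 : Rn R n -> R, weight v -> weight w1 -> weight w2 ->
      ((exists K : R, 0 <= K /\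
          weak_type_bound alpha p t s q1 q2 r1 r2 v w1 w2 K%:E) <->
        (weight_const t q1 q2 r s r1 r2 v w1 w2 < +oo)%E) /\
      ((weight_const t q1 q2 r s r1 r2 v w1 w2 < +oo)%E ->
        weak_type_bound alpha p t s q1 q2 r1 r2 v w1 w2
          (C%:E * weight_const t q1 q2 r s r1 r2 v w1 w2)%E).
Proof.
case/andP: (pq_bounds) => q_gt0 qp; case/andP: (ts_bounds) => t_gt0 ts.
have s_gt0 : 0 < s by exact: lt_le_trans ts.
have rs : rinv r < s^-1.
  move: s_lt_r; rewrite /rinv; case: (r) => [x| |//].
    rewrite lte_fin => sx; have x_gt0 := lt_trans s_gt0 sx.
    by rewrite inver gt_eqF//= ltf_pV2.
  by move=> _; rewrite invey /= invr_gt0.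
exists 1; split => // v w1 w2 [mv _ _] [mw1 w10 _] [mw2 w20 _].
have suff_W : (weight_const t q1 q2 r s r1 r2 v w1 w2 < +oo)%E ->
    weak_type_bound alpha p t s q1 q2 r1 r2 v w1 w2
      (weight_const t q1 q2 r s r1 r2 v w1 w2).
  move=> Wfin; exact: (weak_type_sufficient r1_bounds r2_bounds q_eq s_eq t_eq
    t_gt0 q_gt0 alpha_r mv mw1 mw2 w10 w20 Wfin).
split; last by move=> Wfin; rewrite mul1e; exact: suff_W.
split => [[K [K0 weakK]]|Wfin].
  exact: (weight_const_finite r1_bounds r2_bounds q_eq s_eq pq_bounds rs n_gt0
    mw1 mw2 w10 w20 K0 weakK).
have W0 := weight_const_ge0 t s q1 q2 r1 r2 r v w1 w2.
have Wf : weight_const t q1 q2 r s r1 r2 v w1 w2 \is a fin_num by rewrite ge0_fin_numE.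
exists (fine (weight_const t q1 q2 r s r1 r2 v w1 w2)); rewrite (fineK Wf).
by split; [exact: fine_ge0|exact: suff_W].
Qed.
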